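(* (Sub-Riemannian Gauss Lemma.) Let $\mathbb{G}$ be a Carnot group in which there are no strictly abnormal minimizers. Let $\mathbb{S}(x_0,t)=\{z\in\mathbb{G}: d_c(x_0,z)=t\}$ be the CC-sphere centered at $x_0$ of radius $t\in[0,r]$, and let $\nu_H=\nu_H|_{\mathbb{S}(x_0,t)}$ and $\varpi=\varpi|_{\mathbb{S}(x_0,t)}$ ($t\in[0,r]$). Let $x:[0,r]\to\mathbb{G}$ ($r>0$) be any normal CC-geodesic of unit speed (i.e. $|P_H|=1$), parameterized by arc-length, with initial data $x(0)=x_0$, $P(0)=P_0$, i.e. $x(t)=\exp_{SR}(x_0,P_0)(t)$ for $t\in[0,r]$. Then, for every $t\in[0,r]$, the following system of O.D.E.'s holds (with $\nu_H,\varpi$ evaluated at $x(t)\in\mathbb{S}(x_0,t)$): $$\frac{dx}{dt}=\nu_H,\qquad \frac{d\nu_H}{dt}=-C_H(\varpi)\,\nu_H,\qquad \frac{d\varpi}{dt}=-\mathcal{P}_V\big(C(\varpi)\,\nu_H\big).$$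
   Context: A $k$-step Carnot group $\mathbb{G}$ is a connected, simply connected nilpotent Lie group of dimension $n$ whose Lie algebra is stratified: $\mathfrak{g}=H_1\oplus\dots\oplus H_k$, $[H_1,H_{i-1}]=H_i$ ($i=2,\dots,k$), $[H_1,H_k]=0$. Set $H=H_1$ (horizontal bundle), $V=H_2\oplus\dots\oplus H_k$ (vertical bundle), $h=\dim H$. Fix a left-invariant frame $X_1,\dots,X_n$ adapted to the stratification, with $X_1,\dots,X_h$ spanning $H$ and $X_{h+1},\dots,X_n$ spanning $V$, and the left-invariant Riemannian metric $\langle\cdot,\cdot\rangle$ making it orthonormal; $\mathcal{P}_H,\mathcal{P}_V$ are the orthogonal projections onto $H$, $V$. The Carnot-Carathéodory distance $d_c(p,q)$ is the infimum of the lengths of piecewise smooth horizontal curves (tangent to $H$) joining $p$ to $q$. Structural constants: $C^R_{IJ}:=\langle[X_I,X_J],X_R\rangle$; $C^\alpha=[C^\alpha_{IJ}]_{I,J=1,\dots,n}$ for $\alpha>h$; $C_H^\alpha=[C^\alpha_{ij}]_{i,j=1,\dots,h}$ for $\alpha\in I_{H_2}=\{h+1,\dots,h+\dim H_2\}$. For a vertical vector $Z=\sum_{\alpha>h}z_\alpha X_\alpha$: $C_H(Z)=\sum_{\alpha\in I_{H_2}}z_\alpha C_H^\alpha$, $C(Z)=\sum_{\alpha>h}z_\alpha C^\alpha$. Vectors are identified with their component vectors with respect to the frame $X_1,\dots,X_n$ (horizontal vectors with vectors in $\mathbb{R}^h$, or in $\mathbb{R}^n$ by padding with zeros), and $d\nu_H/dt$,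 $d\varpi/dt$ denote the derivatives of these components along $t\mapsto x(t)$. For a hypersurface with Riemannian unit normal $\nu$, at points where $\mathcal{P}_H\nu\neq0$ put $\nu_H=\mathcal{P}_H\nu/|\mathcal{P}_H\nu|$ and $\varpi=\mathcal{P}_V\nu/|\mathcal{P}_H\nu|$. Along $\mathbb{S}(x_0,t)$ the unit normal $\nu$ is the one in the direction of the Riemannian gradient of $d_c(x_0,\cdot)$. A normal CC-geodesic with initial data $(x_0,P_0)$ is the curve $x(t)=\exp_{SR}(x_0,P_0)(t)$ for which $(x,P)$ solves $$\dot x=P_H:=\sum_{i=1}^hP_iX_i(x),\qquad \dot P=-C(P_V)P_H,\qquad x(0)=x_0,\ P(0)=P_0,$$ with $P=(P_1,\dots,P_n)\in\mathbb{R}^n$ and $P_V=(P_{h+1},\dots,P_n)$, identified with $\sum_{\alpha>h}P_\alpha X_\alpha$. A minimizer is an absolutely continuous horizontal curve that locally minimizes length. An abnormal curve is a horizontal curve that is the projection to $\mathbb{G}$ of an absolutely continuous curve with square-integrable derivative in the annihilator $H^\perp\subset T^*\mathbb{G}$ that does not meet the zero section and whose derivative, whenever it exists, lies in the kernel of the canonical symplectic form restricted to $H^\perp$. A strictly abnormal minimizer is a minimizer that is abnormal and is not a normal CC-geodesic.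
   Formalization: The formal theorem assumes that x(t) lies on S(x_0,t) for all t in [0,r] (false for long geodesics) and that d_c(x_0,·) is differentiable at x(t) for t in (0,r], so that ν exists; at t=0, ν_H and ϖ are taken as limits as t→0+. *)

(* Defs.v *)
From HB Require Import structures.
From mathcomp Require Import all_boot all_order all_algebra.
From mathcomp Require Import all_classical all_reals all_analysis.

Set Implicit Arguments.
Unset Strict Implicit.
Unset Printing Implicit Defensive.

Import Order.TTheory GRing.Theory Num.Theory.
Import numFieldNormedType.Exports.

Local Open Scope classical_set_scope.
Local Open Scope ring_scope.

Section Calculus.
Context {R : realType}.

Fixpoint Ck (U V : normedModType R) (k : nat) (f : U -> V) : Prop :=
  match k with
  | 0 => continuous f
  | k'.+1 => (forall x, differentiable f x)
             /\ forall v, Ck k' (fun x => 'd f x v)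
  end.

Definition smooth (U V : normedModType R) (f : U -> V) := forall k, Ck k f.

(* g has derivative l at t relative to [a, b]: two-sided in the interior,
   one-sided at the endpoints. *)
Definition deriv_in (V : normedModType R) (a b : R) (g : R -> V) (t : R)
    (l : V) : Prop :=
  (fun s => (s - t)^-1 *: (g s - g t)) @ within `[a, b] (t^') --> l.

(* D k is the k-th derivative of g on [a, b]; the existence of such a D says
   that g is C^oo on the closed interval, endpoints included. *)
Definition derivatives_in (V : normedModType R) (a b : R) (g : R -> V)
    (D : nat -> R -> V) : Prop :=
  (forall t, a <= t <= b -> D 0%N t = g t) /\
  (forall k t, a <= t <= b -> deriv_in a b (D k) t (D k.+1 t)).

Definition absolutely_continuous (V : normedModType R) (a b : R) (g : R -> V) :
    Prop :=
  forall e : R, 0 < e -> exists2 d : R, 0 < d &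
    forall (N : nat) (u v : 'I_N -> R),
      (forall i, a <= u i /\ u i <= v i /\ v i <= b) ->
      (forall i j, i != j -> v i <= u j \/ v j <= u i) ->
      \sum_(i < N) (v i - u i) < d ->
      \sum_(i < N) `|g (v i) - g (u i)| < e.

Definition dotv n (p v : 'cV[R]_n) : R := \sum_(i < n) p i 0 * v i 0.

(* The norm `|v| of the library on matrices is the sup norm. *)
Definition enorm n (v : 'cV[R]_n) : R := Num.sqrt (dotv v v).

Definition lie_bracket n (X Y : 'cV[R]_n -> 'cV[R]_n) (x : 'cV[R]_n) :
    'cV[R]_n :=
  'd Y x (X x) - 'd X x (Y x).

End Calculus.

(* A connected, simply connected nilpotent Lie group is diffeomorphic to its
   Lie algebra through exp; it is therefore presented in a global chart, as a
   smooth group law on R^n, and every tangent space is identified with R^n. The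
   chart need not be the exponential one. *)
Record lie_group (R : realType) (n : nat) := LieGroup {
  gmul : 'cV[R]_n -> 'cV[R]_n -> 'cV[R]_n;
  gone : 'cV[R]_n;
  ginv : 'cV[R]_n -> 'cV[R]_n;
  gmulA : associative gmul;
  gmul1 : left_id gone gmul;
  gmulV : left_inverse gone ginv gmul;
  gmul_smooth : smooth (fun z : 'cV[R]_n * 'cV[R]_n => gmul z.1 z.2);
  ginv_smooth : smooth ginv
}.

Section LieAlgebra.
Context {R : realType} {n : nat} (G : lie_group R n).

Definition left_field (u x : 'cV[R]_n) : 'cV[R]_n := 'd (gmul G x) (gone G) u.

(* The Lie algebra is the tangent space at the identity, with the bracket of
   left-invariant fields. *)
Definition bracket (u v : 'cV[R]_n) : 'cV[R]_n :=
  lie_bracket (left_field u) (left_field v) (gone G).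

Definition bracket_space (U W : {vspace 'cV[R]_n}) : {vspace 'cV[R]_n} :=
  <<[seq bracket u w | u <- vbasis U, w <- vbasis W]>>%VS.

Definition layer (e : 'I_n -> 'cV[R]_n) (deg : 'I_n -> nat) (i : nat) :
    {vspace 'cV[R]_n} :=
  <<[seq e j | j <- enum 'I_n & deg j == i]>>%VS.

End LieAlgebra.

(* A Carnot group with a fixed adapted frame: h = dim H, m = dim V, so that
   indices lshift m i are horizontal and indices rshift h a are vertical.
   cdeg I is the index of the layer containing X_I; the decomposition of the
   Lie algebra is direct because the frame is a basis. *)
Record carnot_group (R : realType) (h m : nat) := CarnotGroup {
  cgroup :> lie_group R (h + m);
  cframe : 'I_(h + m) -> 'cV[R]_(h + m);
  cframe_basis : basis_of fullv [seq cframe j | j <- enum 'I_(h + m)];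
  cstep : nat;
  cdeg : 'I_(h + m) -> nat;
  cdeg_range : forall I, (0 < cdeg I <= cstep)%N;
  cdeg_sorted : forall I J : 'I_(h + m), (I <= J)%N -> (cdeg I <= cdeg J)%N;
  cdeg_horizontal : forall I : 'I_(h + m), (cdeg I == 1%N) = (I < h)%N;
  cstep_attained : exists I, cdeg I = cstep;
  cgenerated : forall i, (0 < i < cstep)%N ->
    bracket_space cgroup (layer cframe cdeg 1) (layer cframe cdeg i)
    = layer cframe cdeg i.+1;
  cnilpotent :
    bracket_space cgroup (layer cframe cdeg 1) (layer cframe cdeg cstep) = 0%VS
}.

Section Carnot.
Context {R : realType} {h m : nat} (G : carnot_group R h m).
Local Notation n := (h + m)%N.
Local Notation pt := ('cV[R]_n).
Local Notation mu := (@lebesgue_measure R).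

Definition X (I : 'I_n) : pt -> pt := left_field G (cframe G I).

Definition frame_mx (x : pt) : 'M[R]_n := \matrix_(i, J) X J x i 0.

(* components of the tangent vector v at x with respect to X_1, ..., X_n *)
Definition coords (x v : pt) : 'cV[R]_n := invmx (frame_mx x) *m v.

Definition metric (x v w : pt) : R := dotv (coords x v) (coords x w).

Definition rnorm (x v : pt) : R := Num.sqrt (metric x v v).

Definition horizontal (x v : pt) : Prop := dsubmx (coords x v) = 0.

(* The function <[X_I, X_J], X_K> is constant: it is evaluated at the
   identity. *)
Definition Cmx (K : 'I_n) : 'M[R]_n :=
  \matrix_(I, J) metric (gone G) (lie_bracket (X I) (X J) (gone G))
                        (X K (gone G)).

Definition CV (Z : 'cV[R]_m) : 'M[R]_n :=
  \sum_(a < m) Z a 0 *: Cmx (rshift h a).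

Definition CH (Z : 'cV[R]_m) : 'M[R]_h :=
  \sum_(a < m | cdeg G (rshift h a) == 2%N) Z a 0 *: ulsubmx (Cmx (rshift h a)).

Definition pad (u : 'cV[R]_h) : 'cV[R]_n := col_mx u 0.

Definition hvec (x : pt) (u : 'cV[R]_h) : pt :=
  \sum_(i < h) u i 0 *: X (lshift m i) x.

Definition curve_length (a b : R) (g : R -> pt) : \bar R :=
  \int[mu]_(t in `[a, b]) (rnorm (g t) (derive1 g t))%:E.

Definition smooth_horizontal_arc (a b : R) (g : R -> pt) : Prop :=
  exists2 D, derivatives_in a b g D &
    forall t, a <= t <= b -> horizontal (g t) (D 1%N t).

(* a = t_0 < t_1 < ... < t_N = b with s = [:: t_1; ...; t_N] *)
Definition pw_smooth_horizontal (a b : R) (g : R -> pt) : Prop :=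
  exists s : seq R, path <%R a s /\ last a s = b /\
    forall i, (i < size s)%N ->
      smooth_horizontal_arc (nth a (a :: s) i) (nth a s i) g.

Definition ccdist (p q : pt) : \bar R :=
  ereal_inf [set l | exists a b g, pw_smooth_horizontal a b g /\
                       g a = p /\ g b = q /\ l = curve_length a b g].

Definition ccsphere (x0 : pt) (t : R) : set pt :=
  [set z | ccdist x0 z = t%:E].

(* d_c(x0, .) as a real function; ccdist is finite by Chow's theorem *)
Definition dc (x0 z : pt) : R := fine (ccdist x0 z).

(* components of the Riemannian gradient in the orthonormal frame *)
Definition grad (f : pt -> R) (x : pt) : 'cV[R]_n := \col_J 'd f x (X J x).

(* unit normal at z of the CC-sphere centered at x0 through z *)
Definition unit_normal (x0 z : pt) : 'cV[R]_n :=
  (enorm (grad (dc x0) z))^-1 *: grad (dc x0) z.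

Definition nuH (x0 z : pt) : 'cV[R]_h :=
  (enorm (usubmx (unit_normal x0 z)))^-1 *: usubmx (unit_normal x0 z).

Definition varpi (x0 z : pt) : 'cV[R]_m :=
  (enorm (usubmx (unit_normal x0 z)))^-1 *: dsubmx (unit_normal x0 z).

(* F along x on [0, r], for F defined along x on ]0, r] only: the sphere of
   radius 0 is a point and has no normal, so the value at t = 0 is the limit. *)
Definition along (V : normedModType R) (F : pt -> V) (x : R -> pt) (t : R) : V :=
  if t == 0 then lim (F (x s) @[s --> 0^'+]) else F (x t).

(* x(t) = exp_SR(x0, P0)(t) on [0, r], with dual curve P *)
Definition normal_geodesic (x0 : pt) (P0 : 'cV[R]_n) (r : R)
    (x : R -> pt) (P : R -> 'cV[R]_n) : Prop :=
  [/\ x 0 = x0, P 0 = P0 &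
    forall t, 0 <= t <= r ->
      deriv_in 0 r x t (hvec (x t) (usubmx (P t))) /\
      deriv_in 0 r P t (- (CV (dsubmx (P t)) *m pad (usubmx (P t))))].

Definition ac_horizontal (a b : R) (g : R -> pt) : Prop :=
  absolutely_continuous a b g /\
  {ae mu, forall t, t \in `]a, b[ -> horizontal (g t) (derive1 g t)}.

Definition minimizer (a b : R) (g : R -> pt) : Prop :=
  ac_horizontal a b g /\
  forall t, a <= t <= b -> exists2 d : R, 0 < d &
    forall u v, a <= u -> u <= v -> v <= b -> t - d < u -> v < t + d ->
      forall (c e : R) (w : R -> pt), c <= e -> ac_horizontal c e w ->
        w c = g u -> w e = g v ->
        (curve_length u v g <= curve_length c e w)%E.

(* H^perp in T^*G = R^n x R^n *)
Definition Hperp : set (pt * pt) :=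
  [set z | forall i : 'I_h, dotv z.2 (X (lshift m i) z.1) = 0].

(* H^perp is the common regular zero set of the functions p(X_i(x)) *)
Definition Hperp_tangent (z v : pt * pt) : Prop :=
  forall i : 'I_h,
    'd (fun y : pt * pt => dotv y.2 (X (lshift m i) y.1)) z v = 0.

Definition symplectic (v w : pt * pt) : R := dotv v.2 w.1 - dotv w.2 v.1.

Definition symplectic_kernel (z v : pt * pt) : Prop :=
  Hperp_tangent z v /\ forall w, Hperp_tangent z w -> symplectic v w = 0.

Definition abnormal (a b : R) (g : R -> pt) : Prop :=
  ac_horizontal a b g /\
  exists p : R -> pt,
    let lam := fun t => (g t, p t) in
    [/\ absolutely_continuous a b lam,
        (\int[mu]_(t in `[a, b]) (`|derive1 lam t| ^+ 2)%:E < +oo)%E,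
        forall t, a <= t <= b -> Hperp (lam t) /\ p t != 0 &
        forall t v, a <= t <= b -> deriv_in a b lam t v ->
          symplectic_kernel (lam t) v].

(* Being a normal CC-geodesic is understood up to a monotone change of
   parameter, since minimizers come with an arbitrary parameter. *)
Definition normal_curve (a b : R) (g : R -> pt) : Prop :=
  exists (r : R) (x : R -> pt) (P : R -> 'cV[R]_n) (phi : R -> R),
    [/\ 0 <= r, normal_geodesic (x 0) (P 0) r x P,
        {within `[a, b], continuous phi} /\
        {in `[a, b] &, {homo phi : s t / s <= t}},
        phi a = 0 /\ phi b = r &
        forall t, a <= t <= b -> g t = x (phi t)].

Definition no_strictly_abnormal_minimizers : Prop :=
  forall (a b : R) (g : R -> pt), a < b ->
    minimizer a b g -> abnormal a b g -> normal_curve a b g.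

End Carnot.

(* Main.v *)
(* Transport the covector [P t] to the identity by right translations: the
   equation for [P] says exactly that the result is a constant functional [xi],
   so that [xi (Ad (x t) v) = <P t, v>] for all [t].

   For small times this functional is a calibration. Let [y] be a horizontal
   curve issued from [x0], let [v] be its velocity and [s = |v|], and compare it
   with the geodesic at the time [tau] equal to the length travelled, through
   [z = y x(tau)^-1]. Then [z' = z Ad(x(tau)) (v - s u)] with [u = P_H], and
   [s <u, v - s u> = - |v - s u|^2 / 2] absorbs all second order errors, so that
   [xi (z - 1) + (1 - M tau) |z - 1|^2] decreases. Hence
   [xi (q x(d(q))^-1 - 1) <= 0] for [q] near [x t], where [d] is the distance to
   [x0], with equality at [q = x t]; as [d] is differentiable there, its gradient
   must be [P t].

   For larger [t], the inequality [d (q x(s)^-1 x(t)) <= d q + (t - s)] is an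
   equality at [q = x s]; differentiating it shows that the gradient at [x t] is
   the transport of the gradient at [x s], that is, [P t]. Thus [nu_H = P_H] and
   [varpi = P_V], and the system is the geodesic equation. *)

From HB Require Import structures.
Require Import Defs.
From mathcomp Require Import all_boot all_order all_algebra.
From mathcomp Require Import all_classical all_reals all_analysis.
From mathcomp Require Import measurable_realfun ring lra.
Set Implicit Arguments.
Unset Strict Implicit.
Unset Printing Implicit Defensive.
Import Order.TTheory GRing.Theory Num.Theory.
Import numFieldNormedType.Exports.
Local Open Scope classical_set_scope.
Local Open Scope ring_scope.

(** * Derivatives relative to an interval *)

Section DerivIn.
Context {R : realType}.
Implicit Types (V W : normedModType R) (a b t : R).

(** The classical argument varies a geodesic among geodesics and needs [exp_SR] to cover a
    neighbourhood of [x t] smoothly. Here the distance is only known to be differentiable at the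
    points of the geodesic, so neighbouring points are reached by arbitrary horizontal curves of
    almost minimal length, and the comparison must hold for all of them. The obstacle is that [xi]
    is linear in the chart while [z] moves on the group: replacing a left-invariant field at [z] by
    its value at 1 costs a term of order |z - 1| |v - s u|, which has no sign. This is why the
    weight 1 - M tau decreases: its derivative contributes - M s |z - 1|^2, and together with - |v -
    s u|^2 / (2 s) this dominates the mixed term by completing a square. The price is a bound on
    tau, whence the separate treatment of larger times. Derivatives are taken relative to an
    interval because the geodesic stops at 0 and r and the comparison curves have corners. *)

Lemma deriv_inP V a b (g : R -> V) t (l : V) :
  deriv_in a b g t l <->
  forall e : R, 0 < e -> \forall s \near t, a <= s <= b ->
    `|g s - g t - (s - t) *: l| <= e * `|s - t|.
Proof.
have key s e : s != t -> (`|l - (s - t)^-1 *: (g s - g t)| <= e) =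
    (`|g s - g t - (s - t) *: l| <= e * `|s - t|).
  move=> st; have st0 : s - t != 0 by rewrite subr_eq0.
  rewrite -[in RHS]ler_pdivrMr ?normr_gt0// mulrC -normfV -normrZ.
  by rewrite [in RHS]scalerBr [in RHS]scalerA mulVf// scale1r distrC.
split.
- move=> /cvgrPdist_le gl e e0.
  have := gl e e0; rewrite !near_withinE => H.
  apply: filterS H => s H sab.
  have [->|st] := eqVneq s t; first by rewrite !subrr scale0r subr0 !normr0 mulr0.
  by rewrite -key//; apply: H => //=; rewrite in_itv.
- move=> H; apply/cvgrPdist_le => e e0.
  rewrite !near_withinE; apply: filterS (H _ e0) => s Hs st.
  by rewrite /= in_itv /= => sab; rewrite key// Hs.
Qed.

Lemma deriv_in_ext V a b (f g : R -> V) t l : a <= t <= b ->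
  (forall s, a <= s <= b -> f s = g s) -> deriv_in a b f t l ->
  deriv_in a b g t l.
Proof.
move=> tab fg /deriv_inP H; apply/deriv_inP => e e0.
by apply: filterS (H _ e0) => s Hs sab; rewrite -!fg// Hs.
Qed.

Lemma deriv_in_sub V a b c d (f : R -> V) t l : a <= c -> d <= b ->
  deriv_in a b f t l -> deriv_in c d f t l.
Proof.
move=> ac db /deriv_inP H; apply/deriv_inP => e e0.
apply: filterS (H _ e0) => s Hs /andP[cs sd]; apply: Hs.
by rewrite (le_trans ac)//= (le_trans sd).
Qed.

Lemma deriv_in_bound V a b (g : R -> V) t (l : V) : deriv_in a b g t l ->
  \forall s \near t, a <= s <= b -> `|g s - g t| <= (`|l| + 1) * `|s - t|.
Proof.
move=> /deriv_inP /(_ 1 ltr01); apply: filterS => s H sab.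
rewrite -[g s - g t](subrK ((s - t) *: l)).
apply: le_trans (ler_normD _ _) _; rewrite normrZ mulrDl mul1r addrC.
by apply: lerD; [rewrite mulrC|have := H sab; rewrite mul1r].
Qed.

Lemma near_dist V (t : V) (d : R) : 0 < d -> \forall s \near t, `|s - t| < d.
Proof.
by move=> d0; apply/nbhs_ballP; exists d => // s; rewrite -ball_normE /= distrC.
Qed.

Lemma deriv_in_cvg V a b (g : R -> V) t (l : V) : deriv_in a b g t l ->
  forall e : R, 0 < e -> \forall s \near t, a <= s <= b -> `|g s - g t| < e.
Proof.
move=> /deriv_in_bound H e e0.
have d0 : 0 < e / (`|l| + 1) by rewrite divr_gt0// ltr_wpDl.
apply: filterS2 H (near_dist t d0) => s H st sab.
apply: le_lt_trans (H sab) _.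
by rewrite mulrC -ltr_pdivlMr ?ltr_wpDl.
Qed.

Lemma deriv_in_continuous V a b (g : R -> V) :
  (forall t, a <= t <= b -> exists l, deriv_in a b g t l) ->
  {within `[a, b], continuous g}.
Proof.
move=> H; apply/subspace_continuousP => t; rewrite /= in_itv/= => tab.
have [l Hl] := H _ tab.
apply/cvgrPdist_lt => e e0; rewrite !near_withinE.
have K := deriv_in_cvg Hl e0.
apply: filterS K => s Hs.
by rewrite /= in_itv/= distrC.
Qed.

Lemma deriv_in_is_derive V a b (g : R -> V) t l : a < t < b ->
  deriv_in a b g t l -> is_derive t 1 g l.
Proof.
move=> /andP[ta tb] H.
have D : (fun h => h^-1 *: ((g \o shift t) (h *: 1) - g t)) @ 0^' --> l.
  apply/cvgrPdist_le => e e0.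
  move/deriv_inP: H => /(_ _ e0) H.
  have /nbhs_ballP[d /= d0 Hd] : \forall s \near t,
      `|g s - g t - (s - t) *: l| <= e * `|s - t|.
    have m0 : 0 < Num.min (t - a) (b - t) by rewrite lt_min !subr_gt0 ta.
    apply: filterS2 H (near_dist t m0) => s Hs; rewrite lt_min ltr_distl ltr_distl.
    by move=> st; apply: Hs; lra.
  rewrite /dnbhs near_withinE; exists d => //= h /=.
  rewrite sub0r normrN => hd h0.
  have /Hd : ball t d (h *: 1 + t).
    by rewrite -ball_normE /= opprD addrCA subrr addr0 normrN scaler1.
  rewrite /= addrK [h *: 1]mulr1 => K.
  rewrite distrC -[l](scalerK h0) -scalerBr normrZ normfV mulrC.
  by rewrite ler_pdivrMr ?normr_gt0.
by apply: DeriveDef; [exact: cvgP D|exact: cvg_lim D].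
Qed.

Lemma deriv_in_le a b (f df : R -> R) : a <= b ->
  (forall t, a <= t <= b -> deriv_in a b f t (df t)) ->
  (forall t, a <= t <= b -> df t <= 0) -> f b <= f a.
Proof.
move=> ab fd df0.
have H t : a < t < b -> is_derive t 1 f (df t).
  by move=> /[dup]/andP[? ?] /deriv_in_is_derive; apply; apply: fd; rewrite !ltW.
apply: (@ler0_derive1_le_cc _ f a b) => //.
- by move=> t; rewrite in_itv/= => /H [].
- move=> t; rewrite in_itv/= => /[dup]/andP[? ?] /H [_ K].
  by rewrite derive1E K df0// !ltW.
- by apply: deriv_in_continuous => t /fd; exists (df t).
- by rewrite in_itv/= ab lexx.
- by rewrite in_itv/= ab lexx.
Qed.

End DerivIn.

(** * Rules of calculus for derivatives relative to an interval *)

Section DerivInRules.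
Context {R : realType}.
Implicit Types (V W : normedModType R) (a b t : R).

Lemma differentiable_near V W (F : V -> W) (x : V) : differentiable F x ->
  forall e : R, 0 < e -> \forall y \near x,
    `|F y - F x - 'd F x (y - x)| <= e * `|y - x|.
Proof.
move=> dF e e0; have [_ E] := (diff_locallyP _ _).1 dF.
move/eqaddoP : E => /(_ _ e0) /nbhs_ballP[d /= d0 H].
apply/nbhs_ballP; exists d => //= y; rewrite -ball_normE/= => xy.
have := H (y - x); rewrite -ball_normE /= sub0r normrN distrC.
by move=> /(_ xy); rewrite /= !fctE /= subrK opprD addrA.
Qed.

Lemma diffDE V W (F : V -> W) x u v : 'd F x (u + v) = 'd F x u + 'd F x v.
Proof. exact: raddfD. Qed.

Lemma diffBE V W (F : V -> W) x u v : 'd F x (u - v) = 'd F x u - 'd F x v.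
Proof. exact: raddfB. Qed.

Lemma diffZE V W (F : V -> W) x k u : 'd F x (k *: u) = k *: 'd F x u.
Proof. exact: linearZZ. Qed.

Lemma deriv_in_comp V W (F : V -> W) a b (g : R -> V) t (l : V) :
  a <= t <= b -> differentiable F (g t) -> deriv_in a b g t l ->
  deriv_in a b (F \o g) t ('d F (g t) l).
Proof.
move=> tab dF gl; apply/deriv_inP => e e0.
have [k k0 Hk] := linear_lipschitz (diff_continuous dF).
have L0 : 0 < `|l| + 1 by rewrite ltr_wpDl.
have e1 : 0 < e / (2 * (`|l| + 1)) by rewrite divr_gt0// mulr_gt0.
have e2 : 0 < e / (2 * k) by rewrite divr_gt0// mulr_gt0.
have /nbhs_ballP[d /= d0 Hd] := differentiable_near dF e1.
apply: filterS3 (deriv_in_cvg gl d0) (deriv_in_bound gl)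
  ((deriv_inP _ _ _ _ _).1 gl _ e2) => s H1 H2 H3 sab.
have {}H1 := H1 sab; have {}H2 := H2 sab; have {}H3 := H3 sab.
have /Hd K : ball (g t) d (g s) by rewrite -ball_normE /= distrC.
have -> : (F \o g) s - (F \o g) t - (s - t) *: 'd F (g t) l =
    (F (g s) - F (g t) - 'd F (g t) (g s - g t)) +
    'd F (g t) (g s - g t - (s - t) *: l).
  have -> : 'd F (g t) (g s - g t - (s - t) *: l) =
      'd F (g t) (g s - g t) - (s - t) *: 'd F (g t) l.
    by rewrite diffBE diffZE.
  by rewrite addrA subrK.
apply: le_trans (ler_normD _ _) _.
have -> : e * `|s - t| = e / (2 * (`|l| + 1)) * ((`|l| + 1) * `|s - t|) +
    k * (e / (2 * k) * `|s - t|).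
  by field; rewrite !gt_eqF.
apply: lerD.
  by apply: le_trans K _; apply: ler_wpM2l => //; apply: ltW.
by apply: le_trans (Hk _) _; apply: ler_wpM2l => //; apply: ltW.
Qed.

(** Not an instance of [deriv_in_comp]: [g] may have only a one-sided derivative at [tau s], as a
    geodesic does at its endpoints. The range condition on [tau] ensures that only points of [c, d]
    are compared. *)
Lemma deriv_in_time V a b c d (g : R -> V) (tau : R -> R) s k l :
  a <= s <= b -> (forall u, a <= u <= b -> c <= tau u <= d) ->
  deriv_in a b tau s k -> deriv_in c d g (tau s) l ->
  deriv_in a b (g \o tau) s (k *: l).
Proof.
move=> sab tcd tk gl; apply/deriv_inP => e e0.
have L0 : 0 < `|k| + 1 by rewrite ltr_wpDl.
have L1 : 0 < `|l| + 1 by rewrite ltr_wpDl.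
have e1 : 0 < e / (2 * (`|k| + 1)) by rewrite divr_gt0// mulr_gt0.
have e2 : 0 < e / (2 * (`|l| + 1)) by rewrite divr_gt0// mulr_gt0.
have /nbhs_ballP[r /= d0 Hd] := (deriv_inP _ _ _ _ _).1 gl _ e1.
apply: filterS3 (deriv_in_cvg tk d0) (deriv_in_bound tk)
  ((deriv_inP _ _ _ _ _).1 tk _ e2) => u H1 H2 H3 uab.
have {}H1 := H1 uab; have {}H2 := H2 uab; have {}H3 := H3 uab.
have /Hd/(_ (tcd _ uab)) K : ball (tau s) r (tau u) by rewrite -ball_normE /= distrC.
have -> : (g \o tau) u - (g \o tau) s - (u - s) *: (k *: l) =
    (g (tau u) - g (tau s) - (tau u - tau s) *: l) +
    (tau u - tau s - (u - s) *: k) *: l.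
  have -> : (tau u - tau s - (u - s) *: k) *: l =
      (tau u - tau s) *: l - (u - s) *: (k *: l).
    by rewrite [LHS]scalerBl scalerA.
  by rewrite addrA subrK.
apply: le_trans (ler_normD _ _) _; rewrite normrZ.
have -> : e * `|u - s| = e / (2 * (`|k| + 1)) * ((`|k| + 1) * `|u - s|) +
    (e / (2 * (`|l| + 1)) * `|u - s|) * (`|l| + 1).
  by field; rewrite !gt_eqF.
apply: lerD.
  by apply: le_trans K _; apply: ler_wpM2l => //; apply: ltW.
by apply: ler_pM => //; rewrite lerDl.
Qed.

Lemma deriv_in_pair V W a b (f : R -> V) (g : R -> W) t l l' :
  deriv_in a b f t l -> deriv_in a b g t l' ->
  deriv_in a b (fun s => (f s, g s)) t (l, l').
Proof.
move=> /deriv_inP fl /deriv_inP gl; apply/deriv_inP => e e0.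
apply: filterS2 (fl _ e0) (gl _ e0) => s H1 H2 sab.
by rewrite prod_normE ge_max /= H1// H2.
Qed.

Lemma deriv_in_cst V a b (v : V) t : deriv_in a b (fun=> v) t 0.
Proof.
apply/deriv_inP => e e0; apply: (@filterE _ (nbhs t)) => s _.
by rewrite subrr sub0r scaler0 oppr0 normr0 mulr_ge0// ltW.
Qed.

Lemma deriv_in_id a b t : deriv_in a b (fun s => s) t 1.
Proof.
apply/deriv_inP => e e0; apply: (@filterE _ (nbhs t)) => s _.
by rewrite [_ *: 1]mulr1 subrr normr0 mulr_ge0// ltW.
Qed.

Lemma deriv_inD V a b (f g : R -> V) t l l' :
  deriv_in a b f t l -> deriv_in a b g t l' ->
  deriv_in a b (fun s => f s + g s) t (l + l').
Proof.
move=> fl gl; apply/deriv_inP => e e0.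
have e2 : 0 < e / 2 by rewrite divr_gt0.
apply: filterS2 ((deriv_inP _ _ _ _ _).1 fl _ e2)
  ((deriv_inP _ _ _ _ _).1 gl _ e2) => s H1 H2 sab.
have -> : f s + g s - (f t + g t) - (s - t) *: (l + l') =
  (f s - f t - (s - t) *: l) + (g s - g t - (s - t) *: l').
  by rewrite scalerDr !opprD [X in X + _]addrACA [LHS]addrACA.
apply: le_trans (ler_normD _ _) _.
by rewrite (splitr e) mulrDl lerD// ?H1 ?H2.
Qed.

Lemma deriv_in_sum V a b (I : Type) (r : seq I) (f : I -> R -> V) t
    (l : I -> V) : (forall i, deriv_in a b (f i) t (l i)) ->
  deriv_in a b (fun s => \sum_(i <- r) f i s) t (\sum_(i <- r) l i).
Proof.
move=> H; elim: r => [|i r IH].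
  by rewrite big_nil; under eq_fun do rewrite big_nil; apply: deriv_in_cst.
by rewrite big_cons; under eq_fun do rewrite big_cons; apply: deriv_inD.
Qed.

Lemma deriv_in_scale V a b (f : R -> R) (g : R -> V) t l l' :
  deriv_in a b f t l -> deriv_in a b g t l' ->
  deriv_in a b (fun s => f s *: g s) t (l *: g t + f t *: l').
Proof.
move=> fl gl; apply/deriv_inP => e e0.
(* Three error terms, each allowed a third of [e]: [B] bounds [g] near [t], [C] the product of the
   two increments divided by [(s - t)^2], and [D] the coefficient of the error of [g]. *)
pose B := `|g t| + 1; pose C := `|l| * (`|l'| + 1) + 1; pose D := `|f t| + 1.
have B0 : 0 < B by rewrite ltr_wpDl.
have C0 : 0 < C by rewrite ltr_wpDl// mulr_ge0// addr_ge0.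
have D0 : 0 < D by rewrite ltr_wpDl.
have e1 : 0 < e / (3 * B) by rewrite divr_gt0// mulr_gt0.
have e2 : 0 < e / (3 * C) by rewrite divr_gt0// mulr_gt0.
have e3 : 0 < e / (3 * D) by rewrite divr_gt0// mulr_gt0.
near=> s => sab.
have H1 : `|f s - f t - (s - t) *: l| <= e / (3 * B) * `|s - t|.
  by move: sab; near: s; exact: (deriv_inP _ _ _ _ _).1 fl _ e1.
have H2 : `|g s - g t| < 1.
  by move: sab; near: s; exact: deriv_in_cvg gl _ ltr01.
have H3 : `|g s - g t| <= (`|l'| + 1) * `|s - t|.
  by move: sab; near: s; exact: deriv_in_bound gl.
have H4 : `|g s - g t - (s - t) *: l'| <= e / (3 * D) * `|s - t|.
  by move: sab; near: s; exact: (deriv_inP _ _ _ _ _).1 gl _ e3.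
have H5 : `|s - t| < e / (3 * C) by near: s; exact: (near_dist t e2).
have -> : f s *: g s - f t *: g t - (s - t) *: (l *: g t + f t *: l') =
   (f s - f t - (s - t) *: l) *: g s +
   (((s - t) * l) *: (g s - g t) + f t *: (g s - g t - (s - t) *: l')).
  move: (s - t) => h.
  rewrite !scalerBl !scalerBr scalerDr !scalerA [f t * h]mulrC opprD.
  rewrite -!addrA addKr; congr (_ + _).
  by rewrite [- _ + (f t *: g s + _)]addrCA addKr [RHS]addrCA.
apply: le_trans (ler_normD _ _) _.
have -> : e * `|s - t| = e / (3 * B) * `|s - t| * B +
    (C * (e / (3 * C)) * `|s - t| + D * (e / (3 * D) * `|s - t|)).
  by field; rewrite !gt_eqF.
apply: lerD.
  rewrite normrZ; apply: ler_pM => //.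
  rewrite -[g s](subrK (g t)); apply: le_trans (ler_normD _ _) _.
  by rewrite addrC lerD2l ltW.
apply: le_trans (ler_normD _ _) _; rewrite !normrZ; apply: lerD; last first.
  by apply: ler_pM => //; rewrite lerDl.
rewrite -mulrA mulrC; apply: ler_pM => //.
apply: (@le_trans _ _ (`|l| * ((`|l'| + 1) * `|s - t|))); first by rewrite ler_wpM2l.
rewrite mulrA; apply: ler_pM; rewrite ?mulr_ge0 ?addr_ge0// ?lerDl//.
Unshelve. all: by end_near.
Qed.

(** Since [a < b], the point [t] is not isolated in [a, b]: a nearby [s] is found on its right, or
    on its left when [t = b], and the factor [|s - t|] can be cancelled there. *)
Lemma deriv_in_unique V a b (f : R -> V) t l l' : a < b -> a <= t <= b ->
  deriv_in a b f t l -> deriv_in a b f t l' -> l = l'.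
Proof.
move=> ab /andP[ta tb] /deriv_inP H /deriv_inP H'.
apply/eqP; rewrite -subr_eq0 -normr_le0; apply/ler_addgt0Pl => e e0; rewrite addr0.
have e2 : 0 < e / 2 by rewrite divr_gt0.
have /nbhs_ballP[d /= d0 Hd] : \forall s \near t, a <= s <= b ->
    `|l - l'| * `|s - t| <= e * `|s - t|.
  apply: filterS2 (H _ e2) (H' _ e2) => s K K' sab.
  rewrite mulrC -normrZ.
  have -> : (s - t) *: (l - l') =
      (f s - f t - (s - t) *: l') - (f s - f t - (s - t) *: l).
    by rewrite scalerBr [- (_ - (s - t) *: l)]opprD opprK addrACA subrr add0r addrC.
  apply: le_trans (ler_normB _ _) _.
  by rewrite (splitr e) mulrDl lerD// ?K ?K'.
suff [s [st ts sab]] : exists s, [/\ s != t, `|t - s| < d & a <= s <= b].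
  by have := Hd s ts sab; rewrite ler_pM2r// normr_gt0 subr_eq0.
have [tb'|bt] := ltP t b.
  exists (t + Num.min (d / 2) (b - t)).
  have m0 : 0 < Num.min (d / 2) (b - t) by rewrite lt_min divr_gt0// subr_gt0.
  have m1 : Num.min (d / 2) (b - t) <= d / 2 by rewrite ge_min lexx.
  have m2 : Num.min (d / 2) (b - t) <= b - t by rewrite ge_min lexx orbT.
  split; [by rewrite -subr_eq0 addrAC subrr add0r gt_eqF| |by lra].
  by rewrite opprD addrA subrr add0r normrN gtr0_norm//; lra.
exists (t - Num.min (d / 2) (t - a)).
have m0 : 0 < Num.min (d / 2) (t - a) by rewrite lt_min divr_gt0//=; lra.
have m1 : Num.min (d / 2) (t - a) <= d / 2 by rewrite ge_min lexx.
have m2 : Num.min (d / 2) (t - a) <= t - a by rewrite ge_min lexx orbT.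
split; [by rewrite -subr_eq0 addrAC subrr add0r oppr_eq0 gt_eqF| |by lra].
by rewrite opprB addrC subrK gtr0_norm//; lra.
Qed.

End DerivInRules.

(** * Smooth maps and symmetry of second derivatives *)

Section Smooth.
Context {R : realType}.
Implicit Types (U V W : normedModType R).

Lemma diff_compE U V W (f : U -> V) (g : V -> W) x v :
  differentiable f x -> differentiable g (f x) ->
  'd (g \o f) x v = 'd g (f x) ('d f x v).
Proof. by move=> df dg; rewrite (congr1 (fun k : U -> W => k v) (diff_comp df dg)). Qed.

Lemma is_diffE U V (f df : U -> V) x v : is_diff x f df -> 'd f x v = df v.
Proof. by move=> [_ ->]. Qed.

Lemma Ck_ext U V k (f g : U -> V) : f =1 g -> Ck k f -> Ck k g.
Proof. by move=> /funext ->. Qed.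

Lemma Ck_continuous U V k (f : U -> V) : Ck k f -> continuous f.
Proof. by case: k => // k [df _] x; exact: differentiable_continuous. Qed.

Lemma CkW U V k (f : U -> V) : Ck k.+1 f -> Ck k f.
Proof.
elim: k f => [|k IH] f; first exact: Ck_continuous.
by move=> [df fk]; split => // v; apply: IH.
Qed.

Lemma smooth_differentiable U V (f : U -> V) x : smooth f -> differentiable f x.
Proof. by move=> /(_ 1%N) []. Qed.

Lemma smooth_diff U V (f : U -> V) v : smooth f -> smooth (fun x => 'd f x v).
Proof. by move=> sf k; have [_ /(_ v)] := sf k.+1. Qed.

Lemma Ck_cst U V k (c : V) : Ck k (fun _ : U => c).
Proof.
elim: k c => [|k IH] c; first by move=> x; exact: cvg_cst.
split; first by move=> x; exact: differentiable_cst.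
move=> v; apply: Ck_ext (IH 0) => x.
exact: (esym (congr1 (fun h : U -> V => h v) (diff_cst c x))).
Qed.

Lemma Ck_linear U V k (f : {linear U -> V}) : continuous f -> Ck k f.
Proof.
case: k => // k fc; split; first by move=> x; exact: linear_differentiable.
by move=> v; apply: Ck_ext (Ck_cst _ _ (f v)) => x; rewrite diff_lin.
Qed.

Lemma CkD U V k (f g : U -> V) : Ck k f -> Ck k g -> Ck k (fun x => f x + g x).
Proof.
elim: k f g => [|k IH] f g; first by move=> fc gc x; exact: (cvgD (fc x) (gc x)).
move=> [df fk] [dg gk]; split; first by move=> x; exact: differentiableD.
move=> v; apply: Ck_ext (IH _ _ (fk v) (gk v)) => x.
exact: (esym (congr1 (fun h : U -> V => h v) (diffD (df x) (dg x)))).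
Qed.

Lemma Ck_sum U V k (I : Type) (r : seq I) (f : I -> U -> V) :
  (forall i, Ck k (f i)) -> Ck k (fun x => \sum_(i <- r) f i x).
Proof.
move=> H; elim: r => [|i r IH].
  by apply: Ck_ext (Ck_cst _ _ 0) => x; rewrite big_nil.
by apply: Ck_ext (CkD (H i) IH) => x; rewrite big_cons.
Qed.

Lemma CkM U k (f g : U -> R) : Ck k f -> Ck k g -> Ck k (fun x => f x * g x).
Proof.
elim: k f g => [|k IH] f g; first by move=> fc gc x; exact: (cvgM (fc x) (gc x)).
move=> /[dup] /CkW f' [df fk] /[dup] /CkW g' [dg gk].
split; first by move=> x; exact: differentiableM.
move=> v; apply: Ck_ext (CkD (IH _ _ f' (gk v)) (IH _ _ g' (fk v))) => x.
exact: (esym (congr1 (fun h : U -> R => h v) (diffM (df x) (dg x)))).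
Qed.

(** Meant for affine [A], such as projections and slices of a product. As the differential [L] is
    the same at every point, the derivative of the composite in direction [v] is again of the form
    [g \o A], and the induction closes. *)
Lemma Ck_precomp U V W k (A : U -> V) (L : U -> V) (f : V -> W) :
  (forall x, is_diff x A L) -> Ck k f -> Ck k (f \o A).
Proof.
move=> dA; elim: k f => [|k IH] f.
  move=> fc x; apply: continuous_comp; last exact: fc.
  by apply: differentiable_continuous; case: (dA x).
move=> [df fk]; have dA' x : differentiable A x by case: (dA x).
split; first by move=> x; apply: differentiable_comp.
move=> v; apply: Ck_ext (IH _ (fk (L v))) => x /=.
have := congr1 (fun h : U -> W => h v) (diff_comp (dA' x) (df (A x))).
by move=> /= ->; have [_ ->] := dA x.
Qed.

Lemma Ck_postcomp U V W k (f : U -> V) (L : {linear V -> W}) :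
  continuous L -> Ck k f -> Ck k (L \o f).
Proof.
move=> Lc; elim: k f => [|k IH] f.
  by move=> fc x; apply: continuous_comp; [exact: fc|exact: Lc].
move=> [df fk]; split.
  by move=> x; apply: differentiable_comp => //; exact: linear_differentiable.
move=> v; apply: Ck_ext (IH _ (fk v)) => x /=.
have dL := @linear_differentiable _ _ _ L (f x) Lc.
have := congr1 (fun h : U -> W => h v) (diff_comp (df x) dL).
by move=> /= ->; rewrite diff_lin.
Qed.

Lemma is_diff_line U (p v : U) (s : R) :
  is_diff s (fun s => p + s *: v) (fun k => k *: v).
Proof.
have H := is_diffD (is_diff_cst p s) (is_diff_scalel s v).
by apply: (is_diff_eq H); rewrite add0r.
Qed.

Lemma is_diff_shift U (p x : U) : is_diff x (fun x => x + p) id.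
Proof.
have H := is_diffD (is_diff_id x) (is_diff_cst p x).
by apply: (is_diff_eq H); rewrite addr0.
Qed.

Lemma is_derive_line U (f : U -> R) (p v : U) (s : R) :
  differentiable f (p + s *: v) ->
  is_derive s 1 (fun s => f (p + s *: v)) ('d f (p + s *: v) v).
Proof.
move=> df; have [dl l] := is_diff_line p v s.
have dc : differentiable (f \o (fun s => p + s *: v)) s.
  by apply: differentiable_comp.
apply: DeriveDef; first exact: diff_derivable.
by rewrite deriveE// diff_comp//= l scale1r.
Qed.

Lemma mean_value U (f : U -> R) (p v : U) (e : R) : 0 < e ->
  (forall x, differentiable f x) ->
  exists2 s, 0 < s < e & f (p + e *: v) - f p = e * 'd f (p + s *: v) v.
Proof.
move=> e0 df.
have H (s : R) : is_derive s 1 (fun s => f (p + s *: v)) ('d f (p + s *: v) v).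
  exact: is_derive_line.
have [|s se E] := @MVT R (fun s => f (p + s *: v))
    (fun s => 'd f (p + s *: v) v) 0 e e0 (fun s _ => H s).
  by apply: derivable_within_continuous => s _; case: (H s).
exists s; first by move: se; rewrite in_itv.
by move: E; rewrite scale0r addr0 subr0 mulrC.
Qed.

(** The second difference of [f] on the parallelogram spanned by [e *: u] and [e *: v] is symmetric
    in [u] and [v]. Two mean values, taken in either order, turn it into [e ^+ 2] times a mixed
    derivative at a point close to [a]; continuity of both mixed derivatives concludes. *)
Lemma diff_sym U (f : U -> R) (a u v : U) : Ck 2 f ->
  'd (fun x => 'd f x u) a v = 'd (fun x => 'd f x v) a u.
Proof.
have key w z (e : R) : Ck 2 f -> 0 < e -> exists s t, [/\ 0 < s < e, 0 < t < e &
    f (a + e *: w + e *: z) - f (a + e *: w) - (f (a + e *: z) - f a) =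
    e * (e * 'd (fun x => 'd f x w) (a + s *: w + t *: z) z)].
  move=> [df Hf] e0; have [dw _] := Hf w.
  pose g x := f (x + e *: z) - f x.
  have dsh x : differentiable (fun x => x + e *: z) x.
    by have [] := is_diff_shift (e *: z) x.
  have dfs x : differentiable (f \o (fun x => x + e *: z)) x.
    exact: differentiable_comp.
  have dg x : differentiable g x by apply: (differentiableB (dfs x) (df x)).
  have dgE x y : 'd g x y = 'd f (x + e *: z) y - 'd f x y.
    have E : 'd g x y = _ := congr1 (fun h : U -> R => h y) (diffB (dfs x) (df x)).
    rewrite {}E /=; congr (_ - _).
    have := congr1 (fun h : U -> R => h y) (diff_comp (dsh x) (df (x + e *: z))).
    by move=> /= ->; have [_ ->] := is_diff_shift (e *: z) x.
  have [s se Es] := mean_value a w e0 dg.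
  have [t te Et] := mean_value (a + s *: w) z e0 dw.
  exists s, t; split => //; rewrite -/(g _) -Et -dgE -Es /g.
  by [].
move=> C2f; have [_ Hf] := C2f.
have [_ cu] := Hf u; have [_ cv] := Hf v.
have {}cu := cu v; have {}cv := cv u.
apply/eqP; rewrite -subr_eq0 -normr_le0; apply/ler_addgt0Pl => e e0.
rewrite addr0.
have e2 : 0 < e / 2 by rewrite divr_gt0.
have /cvgrPdist_lt /(_ _ e2) /nbhs_ballP[d1 /= d10 H1] := cu a.
have /cvgrPdist_lt /(_ _ e2) /nbhs_ballP[d2 /= d20 H2] := cv a.
(* With side [d], the whole parallelogram lies within [d * B] of [a], that is, in both continuity
   balls. *)
pose B := `|u| + `|v| + 1; have B0 : 0 < B by rewrite ltr_wpDl ?addr_ge0.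
pose d := Num.min d1 d2 / B; have d0 : 0 < d by rewrite divr_gt0// lt_min d10.
have [s [t [se te E1]]] := key u v _ C2f d0.
have [s' [t' [se' te' E2]]] := key v u _ C2f d0.
have small p q w z : 0 < p < d -> 0 < q < d -> `|w| + `|z| + 1 = B ->
    `|a - (a + p *: w + q *: z)| < Num.min d1 d2.
  move=> /andP[p0 pd] /andP[q0 qd] wz.
  rewrite -addrA opprD addrA subrr sub0r normrN.
  have -> : Num.min d1 d2 = d * B by rewrite divfK// gt_eqF.
  apply: le_lt_trans (ler_normD _ _) _; rewrite !normrZ !gtr0_norm// -wz.
  apply: (@le_lt_trans _ _ (d * (`|w| + `|z|))); last by rewrite ltr_pM2l// ltrDl.
  by rewrite mulrDr lerD// ler_wpM2r// ltW.
have K1 := H1 (a + s *: u + t *: v); have K2 := H2 (a + s' *: v + t' *: u).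
have E : 'd (fun x => 'd f x u) (a + s *: u + t *: v) v =
         'd (fun x => 'd f x v) (a + s' *: v + t' *: u) u.
  have dn0 : d != 0 by rewrite gt_eqF.
  apply: (mulfI dn0); apply: (mulfI dn0); rewrite -E1 -E2.
  by rewrite [a + d *: v + _]addrAC; ring.
move: K1 K2; rewrite -!ball_normE /= E => K1 K2.
apply: ltW; rewrite (splitr e).
apply: le_lt_trans (ler_distD ('d (fun x => 'd f x v) (a + s' *: v + t' *: u) u) _ _) _.
apply: ltrD; [apply: K1|rewrite distrC; apply: K2].
  by apply: lt_le_trans (small _ _ _ _ se te erefl) _; rewrite ge_min lexx.
apply: lt_le_trans (small _ _ _ _ se' te' _) _; first by rewrite /B [`|v| + _]addrC.
by rewrite ge_min lexx orbT.
Qed.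

End Smooth.

(** * Coordinates and linear maps on column vectors *)

Section ColumnVectors.
Context {R : realType}.
Implicit Types (V W : normedModType R) (a b t : R).

Lemma cV_decomp n (v : 'cV[R]_n) : v = \sum_i v i 0 *: delta_mx i 0.
Proof. by rewrite [LHS]matrix_sum_delta; apply: eq_bigr => i _; rewrite big_ord1. Qed.

Lemma coord_norm_le m n (v : 'M[R]_(m, n)) i j : `|v i j| <= `|v|.
Proof.
by rewrite [leRHS]/Num.Def.normr /= mx_normrE; apply/bigmax_geP; right => /=; exists (i, j).
Qed.

Lemma mx_norm_le m n (v : 'M[R]_(m, n)) (e : R) : 0 <= e ->
  (forall i j, `|v i j| <= e) -> `|v| <= e.
Proof.
by move=> e0 H; rewrite [leLHS]/Num.Def.normr /= mx_normrE; apply/bigmax_leP.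
Qed.

Lemma linear_cV_continuous n W (L : {linear 'cV[R]_n -> W}) : continuous L.
Proof.
have -> : (L : _ -> _) = (fun v : 'cV[R]_n => \sum_i v i 0 *: L (delta_mx i 0)).
  apply/funext => v; rewrite [in LHS](cV_decomp v) linear_sum.
  by apply: eq_bigr => i _; rewrite linearZZ.
apply: (@Ck_sum _ _ _ 0%N) => i v.
exact: (cvgZr_tmp (differentiable_continuous (differentiable_coord v i 0))).
Qed.

Lemma deriv_in_linear n W (f : 'cV[R]_n -> W) a b (g : R -> 'cV[R]_n) t l :
  linear f -> a <= t <= b -> deriv_in a b g t l ->
  deriv_in a b (fun s => f (g s)) t (f l).
Proof.
move=> flin tab gl; pose fM := GRing.isLinear.Build _ _ _ _ f flin.
pose L : {linear 'cV[R]_n -> W} := HB.pack f fM.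
have Lc := @linear_cV_continuous n W L.
have := deriv_in_comp tab (@linear_differentiable _ _ _ L (g t) Lc) gl.
by rewrite diff_lin.
Qed.

Lemma deriv_in_coord n a b (g : R -> 'cV[R]_n) t (l : 'cV[R]_n) i : deriv_in a b g t l ->
  deriv_in a b (fun s => g s i 0) t (l i 0).
Proof.
move=> /deriv_inP H; apply/deriv_inP => e e0; apply: filterS (H _ e0) => s Hs sab.
have := le_trans (coord_norm_le _ i 0) (Hs sab).
by rewrite !mxE.
Qed.

Lemma deriv_in_col n a b (g : R -> 'cV[R]_n) t (l : 'cV[R]_n) :
  (forall i, deriv_in a b (fun s => g s i 0) t (l i 0)) -> deriv_in a b g t l.
Proof.
move=> H; apply/deriv_inP => e e0.
have K : \forall s \near t, forall i, a <= s <= b ->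
    `|g s i 0 - g t i 0 - (s - t) *: l i 0| <= e * `|s - t|.
  apply: (@filter_forall _ _ _ (nbhs t)) => i.
  exact: (deriv_inP _ _ _ _ _).1 (H i) _ e0.
apply: filterS K => s Hs sab; apply: mx_norm_le; first by rewrite mulr_ge0// ltW.
by move=> i j; rewrite ord1 !mxE Hs.
Qed.

Lemma coord_linear n (i : 'I_n) :
  exists2 L : {linear 'cV[R]_n -> R}, continuous L & forall M, L M = M i 0.
Proof.
pose f (M : 'cV[R]_n) : R := M i 0.
have flin : linear f by move=> k u v; rewrite /f !mxE.
pose fM := GRing.isLinear.Build _ _ _ _ f flin.
pose L : {linear 'cV[R]_n -> R} := HB.pack f fM.
by exists L => //; exact: linear_cV_continuous.
Qed.

Lemma diff_coord V n (f : V -> 'cV[R]_n) (x v : V) i : differentiable f x ->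
  'd (fun x => f x i 0) x v = ('d f x v) i 0.
Proof.
move=> df; have [L Lc LE] := coord_linear i.
rewrite (_ : (fun x => f x i 0) = L \o f); last first.
  by apply/funext => y; rewrite /= LE.
have dL := @linear_differentiable _ _ _ L (f x) Lc.
have := congr1 (fun g : V -> R => g v) (diff_comp df dL).
by rewrite /= diff_lin// LE.
Qed.

Lemma Ck_coord V n k (f : V -> 'cV[R]_n) i :
  Ck k f -> Ck k (fun x => f x i 0).
Proof.
move=> fk; have [L Lc LE] := coord_linear i.
by apply: Ck_ext (Ck_postcomp Lc fk) => x /=; rewrite LE.
Qed.

End ColumnVectors.

(** * Left translations and the adjoint representation *)

Section LieGroup.
Context {R : realType} {n : nat} (G : lie_group R n).
Local Notation pt := 'cV[R]_n.
Implicit Types (g h u v w x y : pt) (a b t : R).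
Local Notation "x ** y" := (gmul G x y) (at level 40, left associativity).
Local Notation e1 := (gone G).
Local Notation inv := (ginv G).
Local Notation um := (fun z : pt * pt => z.1 ** z.2).

Lemma gmulgV x : x ** inv x = e1.
Proof.
rewrite -[x ** _](gmul1 G) -{1}(gmulV G (inv x)) -gmulA [inv x ** _]gmulA.
by rewrite gmulV gmul1 gmulV.
Qed.

Lemma gmulg1 x : x ** e1 = x.
Proof. by rewrite -(gmulV G x) gmulA gmulgV gmul1. Qed.

Lemma gmulKg x y : inv x ** (x ** y) = y.
Proof. by rewrite gmulA gmulV gmul1. Qed.

Lemma gmulVKg x y : x ** (inv x ** y) = y.
Proof. by rewrite gmulA gmulgV gmul1. Qed.

Lemma ginvM x y : inv (x ** y) = inv y ** inv x.
Proof.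
rewrite -[RHS]gmulg1 -(gmulgV (x ** y)) gmulA -[_ ** _ ** (x ** y)]gmulA gmulKg.
by rewrite gmulV gmul1.
Qed.

Lemma ginvK x : inv (inv x) = x.
Proof. by rewrite -[LHS]gmulg1 -(gmulV G x) gmulKg. Qed.

Lemma ginv1 : inv e1 = e1.
Proof. by rewrite -[LHS]gmulg1 gmulV. Qed.

Lemma differentiable_gmul z : differentiable um z.
Proof. exact/smooth_differentiable/gmul_smooth. Qed.

Lemma differentiable_ginv x : differentiable inv x.
Proof. exact/smooth_differentiable/ginv_smooth. Qed.

Lemma is_diff_inr (p x : pt) : is_diff x (fun q => (p, q)) (fun v => (0, v)).
Proof. exact: (is_diff_pair (is_diff_cst p x) (is_diff_id x)). Qed.

Lemma is_diff_inl (p x : pt) : is_diff x (fun q => (q, p)) (fun v => (v, 0)).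
Proof. exact: (is_diff_pair (is_diff_id x) (is_diff_cst p x)). Qed.

Lemma is_diff_gmull g x : is_diff x (gmul G g) (fun v => 'd um (g, x) (0, v)).
Proof.
have [dr rE] := is_diff_inr g x.
have dc := differentiable_comp dr (differentiable_gmul (g, x)).
apply: DiffDef; first exact: dc.
by apply: etrans (diff_comp dr (differentiable_gmul (g, x))) _; rewrite rE.
Qed.

Lemma is_diff_gmulr g x : is_diff x (fun q => q ** g) (fun v => 'd um (x, g) (v, 0)).
Proof.
have [dr rE] := is_diff_inl g x.
have dc := differentiable_comp dr (differentiable_gmul (x, g)).
apply: DiffDef; first exact: dc.
by apply: etrans (diff_comp dr (differentiable_gmul (x, g))) _; rewrite rE.
Qed.

Lemma differentiable_gmull g x : differentiable (gmul G g) x.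
Proof. by have [] := is_diff_gmull g x. Qed.

Lemma left_fieldE u x : left_field G u x = 'd um (x, e1) (0, u).
Proof. by rewrite /left_field; have [_ ->] := is_diff_gmull x e1. Qed.

Lemma left_field_smooth u : smooth (left_field G u).
Proof.
move=> k; apply: (@Ck_ext _ _ _ _ ((fun z => 'd um z (0, u)) \o (fun q => (q, e1)))).
  by move=> x; rewrite left_fieldE.
by apply: Ck_precomp (is_diff_inl e1) _; apply: smooth_diff; exact: gmul_smooth.
Qed.

Lemma left_field1 u : left_field G u e1 = u.
Proof.
rewrite /left_field (_ : gmul G e1 = id); last by apply/funext => x; rewrite gmul1.
by have [_ ->] := is_diff_id (e1 : pt).
Qed.

Lemma diff_gmul1 u v : 'd um (e1, e1) (u, v) = u + v.
Proof.
have -> : (u, v) = (u, 0) + (0, v) :> pt * pt.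
  by congr pair; rewrite ?addr0 ?add0r.
rewrite diffDE -left_fieldE left_field1; congr (_ + _).
have [_ /(congr1 (fun f : pt -> pt => f u)) /= <-] := is_diff_gmulr e1 e1.
rewrite (_ : (fun q => q ** e1) = id); last by apply/funext => x; rewrite gmulg1.
by have [_ ->] := is_diff_id (e1 : pt).
Qed.

Lemma left_fieldM u g x : left_field G u (g ** x) = 'd (gmul G g) x (left_field G u x).
Proof.
rewrite /left_field (_ : gmul G (g ** x) = gmul G g \o gmul G x); last first.
  by apply/funext => y; rewrite /= gmulA.
have := congr1 (fun f : pt -> pt => f u)
   (diff_comp (differentiable_gmull x e1) (differentiable_gmull g (x ** e1))).
by rewrite gmulg1.
Qed.

Lemma left_field_lin x k u v :
  left_field G (k *: u + v) x = k *: left_field G u x + left_field G v x.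
Proof. by rewrite /left_field diffDE diffZE. Qed.

Lemma left_field_inv g u : left_field G u g = 0 -> u = 0.
Proof.
move=> u0; rewrite -[u]left_field1 -(gmulV G g) left_fieldM u0.
exact: linear0.
Qed.

(** Differentiate p p^-1 = 1 along the line through the identity: by [diff_gmul1] the contributions
    of the two factors add up, and their sum is 0. *)
Lemma diff_ginv1 u : 'd inv e1 u = - u.
Proof.
have zab : 0 <= (0 : R) <= 1 by rewrite lexx ler01.
have dl : deriv_in 0 1 (fun s : R => e1 + s *: u) 0 u.
  have := deriv_inD (deriv_in_cst 0 1 e1 0) (deriv_in_scale (deriv_in_id 0 1 0)
    (deriv_in_cst 0 1 u 0)).
  by rewrite scaler0 addr0 scale1r add0r.
have l0 : e1 + (0 : R) *: u = e1 by rewrite scale0r addr0.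
have dl' := deriv_in_comp zab (differentiable_ginv _) dl.
have := deriv_in_comp zab (differentiable_gmul _) (deriv_in_pair dl dl').
rewrite /= l0 ginv1 diff_gmul1 => d1.
have d2 : deriv_in 0 1 (um \o (fun s : R => (e1 + s *: u, inv (e1 + s *: u)))) 0 0.
  by apply: deriv_in_ext (deriv_in_cst 0 1 e1 0) => // s _ /=; rewrite gmulgV.
have : u + 'd inv e1 u = 0 by apply: deriv_in_unique d1 d2.
by move/eqP; rewrite addrC addr_eq0 => /eqP.
Qed.

End LieGroup.

Section Adjoint.
Context {R : realType} {n : nat} (G : lie_group R n).
Local Notation pt := 'cV[R]_n.
Implicit Types (g h u v w x y : pt) (a b t : R).
Local Notation "x ** y" := (gmul G x y) (at level 40, left associativity).
Local Notation e1 := (gone G).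
Local Notation inv := (ginv G).
Local Notation um := (fun z : pt * pt => z.1 ** z.2).

Definition Ad g v : pt := 'd (fun q => g ** q ** inv g) e1 v.

(** In this form [g] enters only through smooth maps evaluated at [g] and [inv g], so that [Ad] can
    be differentiated in [g]. *)
Lemma AdE g v : Ad g v = 'd um (g, inv g) (left_field G v g, 0).
Proof.
have [dr _] := is_diff_gmulr G (inv g) (g ** e1).
rewrite /Ad -[fun q => _]/((fun q => q ** inv g) \o gmul G g).
rewrite (diff_compE v (differentiable_gmull G g e1) dr).
apply: (etrans (is_diffE _ (is_diff_gmulr G (inv g) (g ** e1)))).
by rewrite gmulg1.
Qed.

Lemma differentiable_conj g x : differentiable (fun q => g ** q ** inv g) x.
Proof.
have [dr _] := is_diff_gmulr G (inv g) (g ** x).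
exact: (differentiable_comp (differentiable_gmull G g x) dr).
Qed.

Lemma conj1 g : g ** e1 ** inv g = e1. Proof. by rewrite gmulg1 gmulgV. Qed.

Lemma AdD g v w : Ad g (v + w) = Ad g v + Ad g w. Proof. exact: diffDE. Qed.

Lemma AdZ g k v : Ad g (k *: v) = k *: Ad g v. Proof. exact: diffZE. Qed.

Lemma AdM g h v : Ad (g ** h) v = Ad g (Ad h v).
Proof.
rewrite /Ad (_ : (fun q => g ** h ** q ** inv (g ** h)) =
    (fun q => g ** q ** inv g) \o (fun q => h ** q ** inv h)); last first.
  by apply/funext => q /=; rewrite ginvM !gmulA.
have := congr1 (fun f : pt -> pt => f v)
  (diff_comp (differentiable_conj h e1) (differentiable_conj g (h ** e1 ** inv h))).
by rewrite /= conj1.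
Qed.

Lemma Ad1 v : Ad e1 v = v.
Proof.
rewrite /Ad (_ : (fun q => e1 ** q ** inv e1) = id); last first.
  by apply/funext => q; rewrite ginv1 gmul1 gmulg1.
by have [_ ->] := is_diff_id (e1 : pt).
Qed.

Lemma AdKV g v : Ad (inv g) (Ad g v) = v.
Proof. by rewrite -AdM gmulV Ad1. Qed.

(** Both sides are the mixed second derivative of the product at (1, 1) in the directions (u, 0) and
    (0, v), because [left_field G v z] is the partial derivative of the product at (z, 1) along (0,
    v). [diff_sym] applies to real functions, hence to each coordinate. *)
Lemma diff_sym_um u v :
  'd (fun z : pt * pt => 'd um z (u, 0)) (e1, e1) (0, v) =
  'd (left_field G v) e1 u.
Proof.
have su := gmul_smooth G.
have sw (w : pt * pt) : smooth (fun z : pt * pt => 'd um z w) by apply: smooth_diff.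
apply/matrixP => i j; rewrite (ord1 j) => {j}.
have C2 : Ck 2 (fun z : pt * pt => um z i 0) by apply: Ck_coord; exact: su.
have := diff_sym (e1, e1) (u, 0) (0, v) C2.
have dE (w z : pt * pt) : 'd (fun z : pt * pt => um z i 0) z w = ('d um z w) i 0.
  exact: diff_coord (differentiable_gmul G z).
under [in LHS]eq_fun do rewrite dE.
under [in RHS]eq_fun do rewrite dE.
rewrite !diff_coord; [|exact: smooth_differentiable..].
move=> ->; congr (fun_of_matrix _ _ _).
have -> : left_field G v = (fun z => 'd um z (0, v)) \o (fun q => (q, e1)).
  by apply/funext => x; rewrite left_fieldE.
have [di _] := is_diff_inl e1 (e1 : pt).
have dw := smooth_differentiable (e1, e1) (sw (0, v)).
by rewrite [RHS](diff_compE _ di dw) (is_diffE u (is_diff_inl e1 (e1 : pt))).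
Qed.

Lemma deriv_in_left a b t (y : R -> pt) (v : pt) h : a <= t <= b ->
  deriv_in a b y t (left_field G v (y t)) ->
  deriv_in a b (fun s => h ** y s) t (left_field G v (h ** y t)).
Proof.
move=> tab yv; rewrite left_fieldM.
exact: (deriv_in_comp tab (differentiable_gmull G h (y t)) yv).
Qed.

Lemma deriv_in_left1 a b t (y : R -> pt) (v : pt) : a <= t <= b ->
  deriv_in a b y t (left_field G v (y t)) ->
  deriv_in a b (fun s => inv (y t) ** y s) t v.
Proof. by move=> tab /(deriv_in_left (h := inv (y t)) tab); rewrite gmulV left_field1. Qed.

Lemma deriv_in_inv1 a b t (c : R -> pt) u : a <= t <= b -> c t = e1 ->
  deriv_in a b c t u -> deriv_in a b (fun s => inv (c s)) t (- u).
Proof.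
move=> tab c1 cu.
have := deriv_in_comp tab (differentiable_ginv G (c t)) cu.
by rewrite c1 diff_ginv1.
Qed.

(* Both factors are moved to the identity by left translations, where the
   product is additive to first order. *)
Lemma deriv_in_quotient a b t (y z : R -> pt) (v w : pt) : a <= t <= b ->
  deriv_in a b y t (left_field G v (y t)) ->
  deriv_in a b z t (left_field G w (z t)) ->
  deriv_in a b (fun s => y s ** inv (z s)) t
    (left_field G (Ad (z t) (v - w)) (y t ** inv (z t))).
Proof.
move=> tab yv zw; pose k := y t ** inv (z t).
have d1 := deriv_in_left1 tab yv.
have d2 := deriv_in_inv1 tab (gmulV G (z t)) (deriv_in_left1 tab zw).
have d3 := deriv_in_comp tab (differentiable_gmul G _) (deriv_in_pair d1 d2).
(* Write y s = y t c1 and z s = z t c2, with c1 and c2 equal to 1 at time [t]. The quotient is then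
   [k] times the conjugate of c1 c2^-1 by [z t], and conjugation is what produces [Ad]. *)
have := deriv_in_comp tab (differentiable_conj (z t) _) d3.
move=> /(deriv_in_comp tab (differentiable_gmull G k _)).
rewrite /= !gmulV ginv1 gmul1 diff_gmul1 conj1.
apply: deriv_in_ext => // s _ /=.
by rewrite /k ginvM ginvK -!gmulA gmulKg gmulVKg gmulgV gmulg1.
Qed.

(** The differential of [Ad] at the identity is the bracket. In [AdE], the motion of
    [left_field G v] gives one half of the bracket; the motion of the base point [(c s, inv (c s))]
    gives the other half, with a minus sign due to the inverse and after exchanging derivatives by
    [diff_sym_um]. *)
Lemma deriv_in_Ad1 a b t (c : R -> pt) u v : a <= t <= b -> c t = e1 ->
  deriv_in a b c t u -> deriv_in a b (fun s => Ad (c s) v) t (bracket G u v).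
Proof.
move=> tab c1 cu.
pose N (w : pt) z := 'd um z (w, 0).
have sN w : smooth (N w) by apply: smooth_diff; exact: gmul_smooth.
have cv' := deriv_in_inv1 tab c1 cu.
have dl : deriv_in a b (fun s => left_field G v (c s)) t ('d (left_field G v) e1 u).
  have dL := smooth_differentiable (c t) (left_field_smooth G v).
  by have := deriv_in_comp tab dL cu; rewrite c1.
have dN i : deriv_in a b (fun s => N (delta_mx i 0) (c s, inv (c s))) t
    (- 'd (N (delta_mx i 0)) (e1, e1) (0, u)).
  have dN := smooth_differentiable (c t, inv (c t)) (sN (delta_mx i 0)).
  have := deriv_in_comp tab dN (deriv_in_pair cu cv').
  rewrite c1 ginv1; congr (deriv_in _ _ _ _ _).
  have -> : (u, - u) = (u, 0) + (0, - u) :> pt * pt.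
    by congr pair; rewrite ?addr0 ?add0r.
  rewrite diffDE; have -> : (0, - u) = - (0, u) :> pt * pt by congr pair; rewrite oppr0.
  (* Moving the base point in its first component alone has no effect: right translation by 1 is the
     identity, so its differential is constantly [delta_mx i 0]. *)
  rewrite [X in _ + X]raddfN [X in X + _](_ : _ = 0) ?add0r//.
  have [di iE] := is_diff_inl e1 (e1 : pt).
  have dN1 := smooth_differentiable (e1, e1) (sN (delta_mx i 0)).
  have := diff_compE u di dN1.
  rewrite (is_diffE u (is_diff_inl e1 (e1 : pt))) => <-.
  rewrite (_ : _ \o _ = cst (delta_mx i 0)); first by rewrite diff_cst.
  apply/funext => q; rewrite /N /=.
  rewrite -(is_diffE _ (is_diff_gmulr G e1 q)).
  rewrite (_ : (fun q => q ** e1) = id); last by apply/funext => x; rewrite gmulg1.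
  exact: (is_diffE _ (is_diff_id q)).
have linN w (M : {linear (pt * pt)%type -> pt}) : M (w, 0) = \sum_i w i 0 *: M (delta_mx i 0, 0).
  rewrite [in LHS](cV_decomp w).
  have inlD : {morph (fun v => (v, 0) : pt * pt) : x y / x + y}.
    by move=> x y; apply/injective_projections; rewrite /= ?addr0.
  rewrite (big_morph _ inlD erefl) linear_sum; apply: eq_bigr => i _.
  by rewrite -linearZZ; congr (M _); congr pair; rewrite scaler0.
have dS i := deriv_in_scale (deriv_in_coord (i := i) dl) (dN i).
have := deriv_in_sum (r := index_enum _) dS.
have -> : \sum_(i <- index_enum _) (('d (left_field G v) e1 u) i 0 *:
      N (delta_mx i 0) (c t, inv (c t)) + left_field G v (c t) i 0 *:
      - 'd (N (delta_mx i 0)) (e1, e1) (0, u)) = bracket G u v.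
  rewrite big_split /bracket /lie_bracket !left_field1; congr (_ + _).
    rewrite c1 ginv1 [RHS]cV_decomp; apply: eq_bigr => i _.
    by rewrite /N diff_gmul1 addr0.
  rewrite c1 left_field1 [X in 'd _ e1 X]cV_decomp linear_sum -sumrN.
  by apply: eq_bigr => i _; rewrite scalerN /N diff_sym_um diffZE.
apply: deriv_in_ext => // s _.
by rewrite AdE linN.
Qed.

(** The bilinear second order term of the product at the identity, whose skew part is the bracket.
    Linearity in [u] is that of a differential; linearity in [v] is visible only after the exchange
    of derivatives in [mixed_diffE]. *)
Definition mixed_diff u v : pt := 'd (left_field G v) e1 u.

Lemma mixed_diffE u v :
  mixed_diff u v = 'd (fun z : pt * pt => 'd um z (u, 0)) (e1, e1) (0, v).
Proof. exact: esym (diff_sym_um u v). Qed.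

Lemma bracketE u v : bracket G u v = mixed_diff u v - mixed_diff v u.
Proof. by rewrite /bracket /lie_bracket !left_field1. Qed.

Lemma mixed_diff_linr u k v w :
  mixed_diff u (k *: v + w) = k *: mixed_diff u v + mixed_diff u w.
Proof.
rewrite !mixed_diffE.
have -> : (0, k *: v + w) = k *: (0, v) + (0, w) :> pt * pt.
  by apply/injective_projections; rewrite /= ?scaler0 ?addr0.
exact: linearP.
Qed.

Lemma mixed_diff_linl u k v w :
  mixed_diff (k *: v + w) u = k *: mixed_diff v u + mixed_diff w u.
Proof. exact: linearP. Qed.

Lemma bracketC u v : bracket G u v = - bracket G v u.
Proof. by rewrite !bracketE opprB. Qed.

Lemma bracket_linr u k v w :
  bracket G u (k *: v + w) = k *: bracket G u v + bracket G u w.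
Proof.
rewrite !bracketE mixed_diff_linr mixed_diff_linl.
move: (mixed_diff u v) (mixed_diff u w) (mixed_diff v u) (mixed_diff w u).
by move=> a b c d; rewrite scalerBr opprD addrACA.
Qed.

Lemma bracket0r u : bracket G u 0 = 0.
Proof.
have := bracket_linr u (-1) 0 0; rewrite scaleN1r oppr0 addr0.
by move: (bracket G u 0) => b; rewrite scaleN1r addNr.
Qed.

Lemma bracketZr u k v : bracket G u (k *: v) = k *: bracket G u v.
Proof. by rewrite -[k *: v]addr0 bracket_linr bracket0r addr0. Qed.

Lemma bracketDr u v w : bracket G u (v + w) = bracket G u v + bracket G u w.
Proof. by have := bracket_linr u 1 v w; rewrite !scale1r. Qed.

Lemma bracket_sumr u (I : Type) (r : seq I) (F : I -> pt) :
  bracket G u (\sum_(i <- r) F i) = \sum_(i <- r) bracket G u (F i).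
Proof. exact: (big_morph _ (bracketDr u) (bracket0r u)). Qed.

Lemma bracket_suml u (I : Type) (r : seq I) (F : I -> pt) :
  bracket G (\sum_(i <- r) F i) u = \sum_(i <- r) bracket G (F i) u.
Proof.
by rewrite bracketC bracket_sumr -sumrN; apply: eq_bigr => i _; rewrite -bracketC.
Qed.

Lemma bracketZl u k v : bracket G (k *: v) u = k *: bracket G v u.
Proof. by rewrite bracketC bracketZr -scalerN -bracketC. Qed.

Lemma mem_bracket_space (U W : {vspace pt}) u w : u \in U -> w \in W ->
  bracket G u w \in bracket_space G U W.
Proof.
move=> uU wW; rewrite (coord_vbasis uU) (coord_vbasis wW) bracket_suml.
apply: memv_suml => i _; rewrite bracket_sumr; apply: memv_suml => j _.
rewrite bracketZl bracketZr !memvZ// /bracket_space memv_span//.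
by apply: allpairs_f; rewrite mem_nth// size_tuple.
Qed.

(** Factoring z s = z t c s reduces to [deriv_in_Ad1] for the inverse of c, whose velocity at the
    identity is [- u], applied to the fixed vector [Ad (inv (z t)) v]. *)
Lemma deriv_in_Ad a b t (z : R -> pt) u v : a <= t <= b ->
  deriv_in a b z t (left_field G u (z t)) ->
  deriv_in a b (fun s => Ad (inv (z s)) v) t (- bracket G u (Ad (inv (z t)) v)).
Proof.
move=> tab zu.
have d2 := deriv_in_inv1 tab (gmulV G (z t)) (deriv_in_left1 tab zu).
have brN w : bracket G (- u) w = - bracket G u w.
  by rewrite -scaleN1r bracketZl scaleN1r.
have := deriv_in_Ad1 (v := Ad (inv (z t)) v) tab _ d2.
rewrite gmulV ginv1 brN => /(_ erefl).
apply: deriv_in_ext => // s _.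
by rewrite -AdM ginvM ginvK -gmulA gmulgV gmulg1.
Qed.

End Adjoint.

(** * The left-invariant frame *)

Section Frame.
Context {R : realType} {h m : nat} (G : carnot_group R h m).
Local Notation n := (h + m)%N.
Local Notation pt := ('cV[R]_n).
Implicit Types (x u v w : pt) (I J K : 'I_n).

Definition frame_vec u : pt := \sum_J u J 0 *: cframe G J.

Lemma frame_vec_delta J : frame_vec (delta_mx J 0) = cframe G J.
Proof.
rewrite /frame_vec (bigD1 J)//= mxE !eqxx scale1r big1 ?addr0// => K KJ.
by rewrite mxE (negbTE KJ) scale0r.
Qed.

Lemma left_field_sum (I : Type) (r : seq I) (F : I -> pt) x :
  left_field G (\sum_(i <- r) F i) x = \sum_(i <- r) left_field G (F i) x.
Proof. exact: raddf_sum. Qed.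

Lemma frame_mxE x u : frame_mx G x *m u = left_field G (frame_vec u) x.
Proof.
rewrite left_field_sum; apply/matrixP => i j; rewrite (ord1 j) => {j}.
rewrite mxE summxE; apply: eq_bigr => J _.
by rewrite /left_field diffZE !mxE mulrC.
Qed.

Lemma frame_vec_eq0 u : frame_vec u = 0 -> u = 0.
Proof.
have := cframe_basis G; rewrite basisEfree => /andP[fr _] u0.
have /freeP/(_ (fun j => u (enum_val j) 0)) := fr.
have -> : \sum_(i < #|'I_n|) u (enum_val i) 0 *:
    (map_tuple [eta cframe G] (enum_tuple 'I_n))`_i = frame_vec u.
  have -> : frame_vec u = \sum_(J in 'I_n) u J 0 *: cframe G J by apply: eq_bigl.
  rewrite [RHS]big_enum_val.
  apply: eq_bigr => i _; congr (_ *: _).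
  have i0 : (i < size (enum 'I_n))%N by rewrite -cardE.
  by rewrite (nth_map (enum_val i))//= -enum_val_nth.
move=> /(_ u0) H; apply/matrixP => J k; rewrite (ord1 k) mxE.
by have := H (enum_rank J); rewrite enum_rankK.
Qed.

Lemma frame_mx_unit x : frame_mx G x \in unitmx.
Proof.
rewrite -unitmx_tr -row_free_unit -kermx_eq0; apply/eqP/row_matrixP => i.
rewrite row0; set k := row i _.
have : k *m (frame_mx G x)^T = 0 by apply/eqP; rewrite -sub_kermx row_sub.
move=> /(congr1 trmx); rewrite trmx_mul trmxK trmx0 frame_mxE.
by move=> /left_field_inv /frame_vec_eq0 /(congr1 trmx); rewrite trmxK trmx0.
Qed.

Definition frame_coord w : pt := coords G (gone G) w.

Lemma coords_left_field x u : coords G x (left_field G (frame_vec u) x) = u.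
Proof. by rewrite /coords -frame_mxE mulKmx// frame_mx_unit. Qed.

Lemma left_field_coords x v : left_field G (frame_vec (coords G x v)) x = v.
Proof. by rewrite /coords -frame_mxE mulKVmx// frame_mx_unit. Qed.

Lemma frame_vecK u : frame_coord (frame_vec u) = u.
Proof. by rewrite -[RHS](coords_left_field (gone G)) left_field1. Qed.

Lemma frame_coordK w : frame_vec (frame_coord w) = w.
Proof. by rewrite -[LHS](left_field1 G) left_field_coords. Qed.

Lemma coordsE x w : coords G x (left_field G w x) = frame_coord w.
Proof. by rewrite -{1}(frame_coordK w) coords_left_field. Qed.

Lemma frame_coord_frame J : frame_coord (cframe G J) = delta_mx J 0.
Proof. by rewrite -frame_vec_delta frame_vecK. Qed.

Lemma frame_coordZ k w : frame_coord (k *: w) = k *: frame_coord w.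
Proof. exact: linearZ. Qed.

Lemma frame_coord_sum (I : Type) (r : seq I) (F : I -> pt) :
  frame_coord (\sum_(i <- r) F i) = \sum_(i <- r) frame_coord (F i).
Proof. exact: linear_sum. Qed.

Lemma hvecE x (u : 'cV[R]_h) : hvec G x u = left_field G (frame_vec (pad u)) x.
Proof.
rewrite left_field_sum /hvec big_split_ord /= [X in _ = _ + X]big1 ?addr0.
  by apply: eq_bigr => i _; rewrite /left_field diffZE /pad col_mxEu.
by move=> i _; rewrite /pad col_mxEd mxE scale0r /left_field; exact: linear0.
Qed.

Lemma CmxE K I J :
  Cmx G K I J = frame_coord (bracket G (cframe G I) (cframe G J)) K 0.
Proof.
have dE L : delta_mx K 0 L 0 = (L == K)%:R :> R by rewrite mxE andbT.
rewrite mxE /metric /X coordsE frame_coord_frame /dotv (bigD1 K)//= big1 => [|L LK].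
  by rewrite addr0 dE eqxx mulr1.
by rewrite dE (negbTE LK) mulr0.
Qed.

Lemma layer_coord i v K : v \in layer (cframe G) (cdeg G) i -> cdeg G K != i ->
  frame_coord v K 0 = 0.
Proof.
move=> vi Ki; rewrite /layer in vi.
pose s := [seq cframe G j | j <- enum 'I_n & cdeg G j == i].
rewrite (@coord_span _ _ _ (in_tuple s) v vi) frame_coord_sum summxE.
apply: big1 => /= j _; rewrite frame_coordZ mxE.
have /mapP[J] : s`_j \in s by rewrite mem_nth.
rewrite mem_filter => /andP[/eqP Ji _] ->.
rewrite frame_coord_frame mxE; case: eqP => [KJ|_]; last by rewrite mulr0.
by rewrite KJ Ji eqxx in Ki.
Qed.

Lemma mem_layer J : cframe G J \in layer (cframe G) (cdeg G) (cdeg G J).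
Proof.
by rewrite memv_span// map_f// mem_filter eqxx mem_enum.
Qed.

(** Bracketing with a horizontal vector sends each layer into the next one, and the last layer to 0.
    This is the only way in which the stratification enters the structural constants. *)
Lemma Cmx_eq0 K I J : (I < h)%N -> cdeg G K != (cdeg G J).+1 -> Cmx G K I J = 0.
Proof.
rewrite -(cdeg_horizontal G) CmxE => /eqP I1 KJ.
have := mem_bracket_space G (mem_layer I) (mem_layer J); rewrite I1.
have /andP[J0] := cdeg_range G J; rewrite leq_eqVlt => /orP[/eqP Jk|Jk].
  rewrite Jk cnilpotent memv0 => /eqP ->.
  by rewrite -[0](scale0r 0) frame_coordZ scale0r mxE.
by rewrite cgenerated ?J0// => /layer_coord; apply.
Qed.

End Frame.

Section DotProduct.
Context {R : realType}.

Lemma deriv_in_dotv n (a b t : R) (f g : R -> 'cV[R]_n) (l l' : 'cV[R]_n) :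
  deriv_in a b f t l -> deriv_in a b g t l' ->
  deriv_in a b (fun s => dotv (f s) (g s)) t (dotv l (g t) + dotv (f t) l').
Proof.
move=> fl gl.
have H i := deriv_in_scale (deriv_in_coord (i := i) fl) (deriv_in_coord (i := i) gl).
have := deriv_in_sum (r := index_enum _) H.
by rewrite /dotv big_split.
Qed.

Lemma deriv_in_const (a b : R) (f : R -> R) : 
  (forall t, a <= t <= b -> deriv_in a b f t 0) ->
  forall t, a <= t <= b -> f t = f a.
Proof.
move=> df t /andP[a_t tb].
have sab s : a <= s <= t -> a <= s <= b.
  by move=> /andP[-> /= st]; exact: le_trans st tb.
apply/eqP; rewrite eq_le; apply/andP; split.
  apply: (@deriv_in_le _ a t f (fun=> 0)) => // s /sab /df.
  exact: deriv_in_sub.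
rewrite -lerN2; apply: (@deriv_in_le _ a t (fun s => - f s) (fun=> 0)) => // s ast.
have := deriv_in_scale (deriv_in_cst a b (-1 : R) s) (df _ (sab _ ast)).
rewrite scale0r scaler0 addr0 => /(deriv_in_sub (lexx a) tb).
by apply: deriv_in_ext => // u _; rewrite scaleN1r.
Qed.

Lemma dotvDr n (p v w : 'cV[R]_n) : dotv p (v + w) = dotv p v + dotv p w.
Proof. by rewrite /dotv -big_split; apply: eq_bigr => i _; rewrite mxE mulrDr. Qed.

Lemma dotvZr n k (p v : 'cV[R]_n) : dotv p (k *: v) = k * dotv p v.
Proof. by rewrite /dotv mulr_sumr; apply: eq_bigr => i _; rewrite mxE mulrCA. Qed.

Lemma dotvNr n (p v : 'cV[R]_n) : dotv p (- v) = - dotv p v.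
Proof. by rewrite -scaleN1r dotvZr mulN1r. Qed.

Lemma dotvC n (p v : 'cV[R]_n) : dotv p v = dotv v p.
Proof. by apply: eq_bigr => i _; rewrite mulrC. Qed.

Lemma dotv_delta n (p : 'cV[R]_n) J : dotv p (delta_mx J 0) = p J 0.
Proof.
rewrite /dotv (bigD1 J)//= big1 => [|I IJ].
  by rewrite mxE !eqxx mulr1 addr0.
by rewrite mxE (negbTE IJ) mulr0.
Qed.

End DotProduct.

(** * Conservation of momentum along normal geodesics *)

Section Momentum.
Context {R : realType} {h m : nat} (G : carnot_group R h m).
Local Notation n := (h + m)%N.
Local Notation pt := ('cV[R]_n).
Implicit Types (p v w : pt) (I J K : 'I_n).

(** The velocity of a geodesic with covector [p], as an element of the Lie algebra. *)
Definition hlift p : pt := frame_vec G (pad (usubmx p)).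

Lemma frame_coord_bracket u v K : frame_coord G
    (bracket G (frame_vec G u) (frame_vec G v)) K 0 =
  \sum_J \sum_I u J 0 * (v I 0 * Cmx G K J I).
Proof.
rewrite /frame_vec bracket_suml frame_coord_sum summxE; apply: eq_bigr => J _.
rewrite bracket_sumr frame_coord_sum summxE; apply: eq_bigr => I _.
rewrite bracketZl bracketZr !frame_coordZ CmxE.
move: (frame_coord _ _) => c; by rewrite !mxE.
Qed.

Lemma CmxC K I J : Cmx G K I J = - Cmx G K J I.
Proof.
rewrite !CmxE bracketC -scaleN1r frame_coordZ.
by move: (frame_coord _ _) => c; rewrite mxE mulN1r.
Qed.

Lemma pad_rshift (u : 'cV[R]_h) (a : 'I_m) : pad u (rshift h a) 0 = 0 :> R.
Proof. by rewrite /pad col_mxEd mxE. Qed.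

(** The dual equation is the coadjoint equation <P', v> = <P, [P_H, v]>. The matrix [CV] sums over
    vertical indices only, whereas the pairing on the right sums over all of them; the horizontal
    ones contribute nothing, since by [Cmx_eq0] a bracket with a horizontal vector has no component
    of degree 1. The skew symmetry of the constants accounts for the sign. *)
Lemma momentum_eq p v :
  dotv (- (CV G (dsubmx p) *m pad (usubmx p))) v =
  dotv p (frame_coord G (bracket G (hlift p) (frame_vec G v))).
Proof.
set u := pad (usubmx p).
have -> : dotv p (frame_coord G (bracket G (hlift p) (frame_vec G v))) =
    \sum_(a < m) \sum_J \sum_I
      p (rshift h a) 0 * (u J 0 * (v I 0 * Cmx G (rshift h a) J I)).
  rewrite /dotv big_split_ord /= big1 ?add0r => [|i _].
    apply: eq_bigr => a _; rewrite frame_coord_bracket mulr_sumr.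
    by apply: eq_bigr => J _; rewrite mulr_sumr.
  rewrite frame_coord_bracket big1 ?mulr0// => J _; rewrite big1// => I _.
  have [j ->|j ->] := split_ordP J; last by rewrite pad_rshift mul0r.
  rewrite Cmx_eq0 ?mulr0//=.
  have -> : cdeg G (lshift m i) = 1%N by apply/eqP; rewrite cdeg_horizontal /=.
  by have /andP[] := cdeg_range G I; case: (cdeg G I).
have -> : dotv (- (CV G (dsubmx p) *m u)) v = \sum_I \sum_J \sum_(a < m)
    p (rshift h a) 0 * (u J 0 * (v I 0 * Cmx G (rshift h a) J I)).
  apply: eq_bigr => I _; rewrite mxE mxE -sumrN mulr_suml; apply: eq_bigr => J _.
  rewrite /CV summxE mulr_suml -sumrN mulr_suml; apply: eq_bigr => a _.
  rewrite mxE CmxC mxE; ring.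
rewrite exchange_big [RHS]exchange_big /=; apply: eq_bigr => J _.
by rewrite exchange_big.
Qed.

Lemma normal_geodesic_deriv x0 P0 r x P t : normal_geodesic G x0 P0 r x P ->
  0 <= t <= r -> deriv_in 0 r x t (left_field G (hlift (P t)) (x t)).
Proof. by move=> [_ _ H] /H[]; rewrite hvecE. Qed.

(** The components [P0] refer to the left-invariant frame at [x0]. Right translation by [x0] carries
    [v] to x0 (x0^-1 v x0), whose components in that frame are those of [Ad (ginv G x0) v]. *)
Definition momentum (x0 P0 v : pt) : R :=
  dotv P0 (frame_coord G (Ad G (ginv G x0) v)).

(** An instance of Noether's principle for left translations: by [momentum_eq] the derivative of [P]
    contributes <P, [P_H, w]> with w = Ad (x^-1) v, and by [deriv_in_Ad] the derivative of w
    contributes the opposite. *)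
Lemma momentum_const x0 P0 r x P t v : normal_geodesic G x0 P0 r x P ->
  0 <= t <= r -> momentum (x t) (P t) v = momentum x0 P0 v.
Proof.
move=> Hx t0r; have [<- <- _] := Hx.
apply: (@deriv_in_const _ _ r (fun t => momentum (x t) (P t) v)) => // s s0r.
have dx := normal_geodesic_deriv Hx s0r.
have [_ _ /(_ _ s0r)[_ dP]] := Hx.
have dA := deriv_in_Ad (v := v) s0r dx.
have L : linear (frame_coord G) by move=> k a b; exact: linearP.
have dB := deriv_in_linear L s0r dA.
have := deriv_in_dotv dP dB; rewrite /= momentum_eq frame_coordK.
have -> : frame_coord G (- bracket G (hlift (P s)) (Ad G (ginv G (x s)) v)) =
  - frame_coord G (bracket G (hlift (P s)) (Ad G (ginv G (x s)) v)).
  by rewrite -scaleN1r frame_coordZ scaleN1r.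
by rewrite dotvNr subrr.
Qed.

Lemma momentum_Ad x0 P0 r x P t v : normal_geodesic G x0 P0 r x P ->
  0 <= t <= r -> momentum x0 P0 (Ad G (x t) v) = dotv (P t) (frame_coord G v).
Proof.
by move=> Hx t0r; rewrite -(momentum_const _ Hx t0r) /momentum AdKV.
Qed.

Lemma momentumZ x0 P0 k v : momentum x0 P0 (k *: v) = k * momentum x0 P0 v.
Proof. by rewrite /momentum AdZ frame_coordZ dotvZr. Qed.

Lemma momentumD x0 P0 v w :
  momentum x0 P0 (v + w) = momentum x0 P0 v + momentum x0 P0 w.
Proof. by rewrite /momentum AdD -dotvDr /frame_coord /coords mulmxDr. Qed.

End Momentum.

(** * Arc length *)

Section Antiderivative.
Context {R : realType}.
Local Notation mu := (@lebesgue_measure R).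

(** The retraction of the line onto [c, d]. Precomposing with it extends a function continuous on
    [c, d] to the whole line, so that its integral has two-sided derivatives even at [c] and [d]. *)
Definition clamp (c d t : R) : R := Num.max c (Num.min d t).

Lemma clamp_itv c d t : c <= d -> c <= clamp c d t <= d.
Proof. by move=> cd; rewrite /clamp le_max lexx /= ge_max cd /= ge_min lexx. Qed.

Lemma clamp_id c d t : c <= t <= d -> clamp c d t = t.
Proof. by move=> /andP[ct td]; rewrite /clamp min_r// max_r. Qed.

Lemma clamp_dist c d s t : `|clamp c d s - clamp c d t| <= `|s - t|.
Proof.
have := ler_norm (s - t); have := ler_norm (t - s); have := normr_ge0 (s - t).
rewrite [`|t - s|]distrC ler_norml; move: `|s - t| => q q0 q1 q2.
by rewrite /clamp !maxEle !minEle; do !case: ifPn; rewrite -?ltNge => *; lra.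
Qed.

Lemma continuous_clamp c d (f : R -> R) : c <= d ->
  {within `[c, d], continuous f} -> continuous (f \o clamp c d).
Proof.
move=> cd /subspace_continuousP fc t.
have := fc (clamp c d t); rewrite /= in_itv /= clamp_itv// => /(_ isT) ft.
apply/cvgrPdist_lt => e e0.
have /cvgrPdist_lt/(_ _ e0) := ft; rewrite !near_withinE => /nbhs_ballP[r /= r0 H].
apply: filterS (near_dist t r0) => s st /=.
apply: H; last by rewrite /= in_itv/= clamp_itv.
by rewrite -ball_normE /= distrC; apply: le_lt_trans st; exact: clamp_dist.
Qed.

Lemma is_derive_deriv_in (V : normedModType R) (a b : R) (f : R -> V) (t : R) (l : V) :
  is_derive t 1 f l -> deriv_in a b f t l.
Proof.
move=> [df fl]; apply/deriv_inP => e e0.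
have : (fun h => h^-1 *: (f (h *: 1 + t) - f t)) @ 0^' --> l.
  by have := df; rewrite -fl.
move=> /cvgrPdist_le /(_ _ e0); rewrite /dnbhs near_withinE => -[r /= r0 H].
apply: filterS (near_dist t r0) => s st _.
have [->|nst] := eqVneq s t; first by rewrite !subrr scale0r subr0 !normr0 mulr0.
have st0 : s - t != 0 by rewrite subr_eq0.
have := H (s - t); rewrite /= sub0r normrN => /(_ st st0).
rewrite [(s - t) *: 1]mulr1 subrK => K.
have -> : f s - f t - (s - t) *: l = - ((s - t) *: (l - (s - t)^-1 *: (f s - f t))).
  by rewrite scalerBr scalerA mulfV// scale1r opprB.
by rewrite normrN normrZ mulrC ler_wpM2r.
Qed.

Lemma antiderivative c d (f : R -> R) : c < d ->
  {within `[c, d], continuous f} ->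
  exists2 L : R -> R, L c = 0 /\ (\int[mu]_(t in `[c, d]) (f t)%:E = (L d)%:E)%E &
    forall t, c <= t <= d -> deriv_in c d L t (f t).
Proof.
move=> cd fc; have fk := continuous_clamp (ltW cd) fc.
set k := f \o clamp c d in fk.
(* Integration starts at [c - 1] so that [c] is an interior point; the value [F c] is subtracted
   afterwards. *)
pose F x := (\int[mu]_(t in `[c - 1, x]) (k t))%R.
have dF t : c <= t <= d -> is_derive t 1 F (k t).
  move=> /andP[ct td].
  have [|||dF F'] := @continuous_FTC1_closed R k (c - 1) t (d + 1) _ _ _ (fk t).
  - lra.
  - by apply: continuous_compact_integrable; [exact: segment_compact|exact: continuous_subspaceT].
  - lra.
  - by apply: DeriveDef; [exact: dF|rewrite -derive1E].
have dFin t : c <= t <= d -> deriv_in c d F t (f t).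
  move=> tcd; have := dF t tcd; rewrite /k /= clamp_id//; exact: is_derive_deriv_in.
exists (fun t => F t - F c); first split.
- by rewrite subrr.
- rewrite EFinB -(@continuous_FTC2 R f F c d cd fc)//.
    have Fc : {within `[c, d], continuous F}.
      by apply: deriv_in_continuous => t /dFin; exists (f t).
    have [_ Fcc Fcd] := (continuous_within_itvP _ cd).1 Fc.
    split => // t; rewrite in_itv/= => /andP[ct td].
    by have [] : is_derive t 1 F (k t) by apply: dF; rewrite !ltW.
  move=> t; rewrite in_itv/= => /andP[ct td].
  have tcd : c <= t <= d by rewrite !ltW.
  by have [_ E] := dF t tcd; rewrite derive1E E /k /= clamp_id.
- move=> t tcd; have := deriv_inD (dFin t tcd) (deriv_in_cst c d (- F c) t).
  by rewrite addr0.
Qed.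

End Antiderivative.

(** * Speed and length of smooth arcs *)

Section ArcLength.
Context {R : realType} {h m : nat} (G : carnot_group R h m).
Local Notation n := (h + m)%N.
Local Notation pt := ('cV[R]_n).
Local Notation mu := (@lebesgue_measure R).
Implicit Types (y : R -> pt) (a b c d t : R).

(** Translating [v] to the identity replaces the inverse of the frame matrix by the differential of
    the product, which is smooth in [x]. Continuity of the speed of a curve follows from it. *)
Lemma coords_gmul (x v : pt) : coords G x v =
  frame_coord G ('d (fun z : pt * pt => gmul G z.1 z.2) (ginv G x, x) (0, v)).
Proof.
rewrite -{2}(left_field_coords G x v) -(is_diffE _ (is_diff_gmull G (ginv G x) x)).
by rewrite -left_fieldM gmulV left_field1 frame_vecK.
Qed.

Lemma deriv_in_coords a b t y (w : R -> pt) l l' : a <= t <= b ->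
  deriv_in a b y t l -> deriv_in a b w t l' ->
  exists k, deriv_in a b (fun s => coords G (y s) (w s)) t k.
Proof.
move=> tab yl wl.
pose N v z := 'd (fun z : pt * pt => gmul G z.1 z.2) z ((0, v) : pt * pt).
have sN v : smooth (N v) by apply: smooth_diff; exact: gmul_smooth.
have il := deriv_in_comp tab (differentiable_ginv G (y t)) yl.
have pl := deriv_in_pair il yl.
have Nl J := deriv_in_comp tab (smooth_differentiable _ (sN (delta_mx J 0))) pl.
have S J := deriv_in_scale (deriv_in_coord (i := J) wl) (Nl J).
have := deriv_in_sum (r := index_enum _) S.
have L : linear (frame_coord G) by move=> k u v; exact: linearP.
move=> /(deriv_in_linear L tab) H; eexists; apply: deriv_in_ext H => // s _.
rewrite coords_gmul; congr (frame_coord G _).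
have linN (v : pt) (M : {linear (pt * pt)%type -> pt}) :
    M (0, v) = \sum_J v J 0 *: M (0, delta_mx J 0).
  rewrite [in LHS](cV_decomp v).
  have inrD : {morph (fun v => (0, v) : pt * pt) : x y / x + y}.
    by move=> u w'; apply/injective_projections; rewrite /= ?addr0.
  rewrite (big_morph _ inrD erefl) linear_sum; apply: eq_bigr => i _.
  by rewrite -linearZZ; congr (M _); apply/injective_projections; rewrite /= ?scaler0.
by rewrite linN.
Qed.

Lemma speed_continuous c d y (w l l' : R -> pt) :
  (forall t, c <= t <= d -> deriv_in c d y t (l t)) ->
  (forall t, c <= t <= d -> deriv_in c d w t (l' t)) ->
  {within `[c, d], continuous (fun t => rnorm G (y t) (w t))}.
Proof.
move=> yl wl.
pose f t := dotv (coords G (y t) (w t)) (coords G (y t) (w t)).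
have fc : {within `[c, d], continuous f}.
  apply: deriv_in_continuous => t tcd.
  have [k H] := deriv_in_coords tcd (yl t tcd) (wl t tcd).
  by have := deriv_in_dotv H H; eexists; eassumption.
move=> t; apply: continuous_comp; first exact: fc.
exact: sqrt_continuous.
Qed.

(* The two-sided derivative is only used inside the interval; the endpoints are
   negligible. *)
Lemma arc_length c d y (D : nat -> R -> pt) : c < d -> derivatives_in c d y D ->
  measurable_fun `[c, d] (fun t => rnorm G (y t) (derive1 y t)) /\
  exists2 L : R -> R, L c = 0 /\ curve_length G c d y = (L d)%:E &
    forall t, c <= t <= d -> deriv_in c d L t (rnorm G (y t) (D 1%N t)).
Proof.
move=> cd [D0 DS].
have yl t : c <= t <= d -> deriv_in c d y t (D 1%N t).
  by move=> tcd; apply: deriv_in_ext (DS 0%N t tcd).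
have sc := speed_continuous yl (DS 1%N).
set f := fun t => rnorm G (y t) (D 1%N t) in sc.
have [L [Lc Ld] LD] := antiderivative cd sc.
have eqf : {in `]c, d[%classic, f =1 (fun t => rnorm G (y t) (derive1 y t))}.
  move=> t; rewrite inE /= in_itv/= => tcd.
  have [t1 t2] := andP tcd.
  have tcd' : c <= t <= d by rewrite !ltW.
  have [_ E] := deriv_in_is_derive tcd (yl t tcd').
  by rewrite derive1E E.
have mf : measurable_fun `]c, d[ f.
  apply: (@measurable_funS _ _ _ _ `[c, d]%classic) => //.
    exact: subset_itv_oo_cc.
  exact: subspace_continuous_measurable_fun.
have mg := eq_measurable_fun _ eqf mf.
split.
  have E : `[c, d]%classic = c |` (`]c, d[%classic `|` [set d]).
    by rewrite setUitv1// ?setU1itv// bnd_simp ltW.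
  rewrite E.
  apply/measurable_funU; [by []|exact: measurableU|split].
    exact: measurable_fun_set1.
  by apply/measurable_funU => //; split => //; exact: measurable_fun_set1.
exists L => //; split => //; rewrite -Ld /curve_length.
rewrite integral_itv_bndoo; last by apply/measurable_EFinP.
rewrite [RHS]integral_itv_bndoo; last by apply/measurable_EFinP.
by apply: eq_integral => t /eqf ->.
Qed.

Lemma curve_length_ge0 a b y : (0 <= curve_length G a b y)%E.
Proof. by apply: integral_ge0 => t _; rewrite lee_fin sqrtr_ge0. Qed.

Lemma curve_length_cat a c b y : a <= c -> c <= b ->
  measurable_fun `[a, c] (fun t => rnorm G (y t) (derive1 y t)) ->
  measurable_fun `[c, b] (fun t => rnorm G (y t) (derive1 y t)) ->
  measurable_fun `[a, b] (fun t => rnorm G (y t) (derive1 y t)) /\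
  curve_length G a b y = (curve_length G a c y + curve_length G c b y)%E.
Proof.
move=> ac cb m1 m2.
have U : `[a, b]%classic = `[a, c]%classic `|` `]c, b]%classic.
  by rewrite -itv_bndbnd_setU//= bnd_simp.
have m2' : measurable_fun `]c, b] (fun t => rnorm G (y t) (derive1 y t)).
  apply: measurable_funS m2 => // t; rewrite /= !in_itv/=.
  by move=> /andP[/ltW -> ->].
have mU : measurable_fun (`[a, c]%classic `|` `]c, b]%classic)
    (fun t => rnorm G (y t) (derive1 y t)) by apply/measurable_funU.
split; first by rewrite U.
rewrite /curve_length U ge0_integral_setU//=.
- by congr (_ + _)%E; rewrite integral_itv_obnd_cbnd//; exact/measurable_EFinP.
- exact/measurable_EFinP.
- by move=> t _; rewrite lee_fin sqrtr_ge0.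
- apply/disj_setPS => t [/=]; rewrite !in_itv/= => /andP[_ tc] /andP[ct _].
  by rewrite ltNge tc in ct.
Qed.

End ArcLength.

(** * Calibration of short geodesics *)

Section Barrier.
Context {R : realType}.

Lemma deriv_in_mono (a b : R) (f df : R -> R) : 
  (forall t, a <= t <= b -> deriv_in a b f t (df t)) ->
  (forall t, a <= t <= b -> 0 <= df t) ->
  forall s t, a <= s -> s <= t -> t <= b -> f s <= f t.
Proof.
move=> fd df0 s t a_s st tb; rewrite -lerN2.
have sub u : s <= u <= t -> a <= u <= b.
  by move=> /andP[su ut]; rewrite (le_trans a_s)// (le_trans ut).
apply: (@deriv_in_le _ s t (fun u => - f u) (fun u => - df u)) => // u /[dup] sut /sub uab; last first.
  by rewrite oppr_le0 df0.
have := deriv_in_scale (deriv_in_cst a b (-1 : R) u) (fd _ uab).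
rewrite scale0r add0r scaleN1r => /(deriv_in_sub a_s tb).
by apply: deriv_in_ext => // k _; rewrite scaleN1r.
Qed.

(** A continuity argument: the sign of the derivative is known only while [f] stays below the
    positive level [e]. At the last time where [f] is nonpositive, continuity keeps [f] below [e] a
    little longer, so [f] does not increase there and that time was not the last. It serves to keep
    [z] inside the ball where the estimates hold. *)
Lemma barrier (c d e : R) (f df : R -> R) : 0 < e -> c <= d ->
  (forall t, c <= t <= d -> deriv_in c d f t (df t)) ->
  f c <= 0 -> (forall t, c <= t <= d -> f t <= e -> df t <= 0) -> f d <= 0.
Proof.
move=> e0 cd fd fc fe; rewrite leNgt; apply/negP => fd0.
pose S := [set s | c <= s <= d /\ f s <= 0].
have Sc : S c by split => //; rewrite lexx.
have Sub : ubound S d by move=> s [/andP[]].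
have hS : has_sup S by split; [exists c|exists d].
pose t := sup S.
have ct : c <= t by apply: ub_le_sup => //; exists d.
have td : t <= d by apply: sup_le_ub => //; exists c.
have tcd : c <= t <= d by rewrite ct.
have near_t (k : R) : 0 < k -> exists2 r : R, 0 < r &
    forall s, `|s - t| < r -> c <= s <= d -> `|f s - f t| < k.
  move=> k0; have /nbhs_ballP[r /= r0 H] := deriv_in_cvg (fd _ tcd) k0.
  by exists r => // s st scd; apply: H => //; rewrite -ball_normE /= distrC.
have ft : f t <= 0.
  rewrite leNgt; apply/negP => ft0.
  have [r r0 H] := near_t _ ft0.
  have [s [scd fs] ts] := sup_adherent r0 hS.
  have st : s <= t by apply: ub_le_sup => //; exists d.
  have : `|s - t| < r by rewrite ler0_norm ?subr_le0// opprB ltrBlDr -ltrBlDl.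
  move=> /H /(_ scd); rewrite ltr_norml => /andP[]; lra.
have {}td : t < d by rewrite lt_neqAle td andbT; apply/eqP => E; rewrite -E in fd0; lra.
have [r r0 H] := near_t _ e0.
pose s := Num.min (t + r / 2) d.
have ts : t < s by rewrite lt_min td andbT; lra.
have sd : s <= d by rewrite ge_min lexx orbT.
have sr : s <= t + r / 2 by rewrite ge_min lexx.
have fs : f s <= f t.
  apply: (@deriv_in_le _ t s f df); [exact: ltW| |].
    move=> u /andP[tu us]; apply: (deriv_in_sub ct sd); apply: fd.
    by rewrite (le_trans ct tu) (le_trans us sd).
  move=> u /andP[tu us].
  have ucd : c <= u <= d by rewrite (le_trans ct tu) (le_trans us sd).
  apply: fe => //; have := H u; rewrite ger0_norm ?subr_ge0//.
  have -> : u - t < r by lra.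
  by move=> /(_ isT ucd); rewrite ltr_norml => /andP[]; lra.
have : s <= t.
  apply: ub_le_sup; first by exists d.
  split; last exact: le_trans fs ft.
  by rewrite sd (le_trans ct (ltW ts)).
by rewrite leNgt ts.
Qed.

End Barrier.

Section Norms.
Context {R : realType}.

Lemma dotv_ge0 n (v : 'cV[R]_n) : 0 <= dotv v v.
Proof. by apply: sumr_ge0 => i _; rewrite -expr2 sqr_ge0. Qed.

Lemma enorm_sqr n (v : 'cV[R]_n) : enorm v ^+ 2 = dotv v v.
Proof. by rewrite sqr_sqrtr// dotv_ge0. Qed.

Lemma norm_sqr_le n (v : 'cV[R]_n) : `|v| ^+ 2 <= dotv v v.
Proof.
rewrite -[leRHS]sqr_sqrtr ?dotv_ge0// ler_sqr ?nnegrE ?sqrtr_ge0//.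
apply: mx_norm_le; first exact: sqrtr_ge0.
move=> i j; rewrite (ord1 j) -sqrtr_sqr; apply: ler_wsqrtr.
rewrite /dotv (bigD1 i)//= -expr2 lerDl.
by apply: sumr_ge0 => k _; rewrite -expr2 sqr_ge0.
Qed.

Lemma norm_le_enorm n (v : 'cV[R]_n) : `|v| <= enorm v.
Proof. by rewrite -ler_sqr ?nnegrE ?sqrtr_ge0// enorm_sqr norm_sqr_le. Qed.

Lemma dotv_norm_le n (v w : 'cV[R]_n) : `|dotv v w| <= n%:R * `|v| * `|w|.
Proof.
apply: le_trans (ler_norm_sum _ _ _) _.
have -> : n%:R * `|v| * `|w| = \sum_(i < n) `|v| * `|w|.
  by rewrite sumr_const card_ord -mulrA mulr_natl.
by apply: ler_sum => i _; rewrite normrM ler_pM// coord_norm_le.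
Qed.

Lemma linear_cV_bound n (W : normedModType R) (f : 'cV[R]_n -> W) : linear f ->
  exists2 k, 0 < k & forall v, `|f v| <= k * `|v|.
Proof.
move=> L; pose Lm := GRing.isLinear.Build _ _ _ _ f L.
pose LL : {linear 'cV[R]_n -> W} := HB.pack f Lm.
exact: (linear_lipschitz (@linear_cV_continuous _ _ _ LL)).
Qed.

Lemma differentiable_lip (V W : normedModType R) (F : V -> W) (x : V) :
  differentiable F x ->
  exists2 k, 0 < k & \forall y \near x, `|F y - F x| <= k * `|y - x|.
Proof.
move=> dF; have [k k0 Hk] := linear_lipschitz (diff_continuous dF).
exists (k + 1); first by rewrite addr_gt0.
apply: filterS (differentiable_near dF ltr01) => y H.
rewrite -[F y - F x](subrK ('d F x (y - x))) addrC mulrDl.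
by apply: le_trans (ler_normD _ _) _; rewrite lerD.
Qed.

End Norms.

(** * Local bounds for left-invariant fields and for the adjoint action *)

Section Constants.
Context {R : realType} {h m : nat} (G : carnot_group R h m).
Local Notation n := (h + m)%N.
Local Notation pt := ('cV[R]_n).
Local Notation e1 := (gone G).

Lemma linear_basis_bound (f : pt -> pt) (k : R) :
  linear f -> (forall i, `|f (delta_mx i 0)| <= k) ->
  forall w, `|f w| <= n%:R * k * `|w|.
Proof.
move=> flin H w; pose Lm := GRing.isLinear.Build _ _ _ _ f flin.
pose LL : {linear 'cV[R]_n -> 'cV[R]_n} := HB.pack f Lm.
have -> : f w = \sum_i w i 0 *: f (delta_mx i 0).
  rewrite {1}(cV_decomp w); have := linear_sum LL => /= ->.
  by apply: eq_bigr => i _; have := linearZZ LL => /= ->.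
apply: le_trans (ler_norm_sum _ _ _) _.
have -> : n%:R * k * `|w| = \sum_(i < n) `|w| * k.
  by rewrite sumr_const card_ord -mulrA mulr_natl mulrC.
by apply: ler_sum => i _; rewrite normrZ ler_pM// coord_norm_le.
Qed.

(** Each basis field is Lipschitz at the identity; linearity in [w] makes the constant uniform. This
    error is what the quadratic term of the calibration has to absorb. *)
Lemma left_field_near1 : exists C rho : R, [/\ 0 < C, 0 < rho &
  forall z w, `|z - e1| <= rho ->
    `|left_field G w z - w| <= C * `|z - e1| * `|w|].
Proof.
have H i : exists k : R, 0 < k /\ \forall z \near e1,
    `|left_field G (delta_mx i 0) z - delta_mx i 0| <= k * `|z - e1|.
  have [k k0 K] := differentiable_lip
    (smooth_differentiable e1 (left_field_smooth G (delta_mx i 0))).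
  by exists k; split => //; rewrite left_field1 in K.
have [k kP] := choice H.
pose C := \sum_i k i + 1.
have kC i : k i <= C.
  rewrite /C (bigD1 i)//= -addrA lerDl addr_ge0//.
  by apply: sumr_ge0 => j _; apply: ltW; have [] := kP j.
have C0 : 0 < C.
  by rewrite ltr_wpDl// sumr_ge0// => j _; apply: ltW; have [] := kP j.
have /nbhs_ballP[r /= r0 Hr] : \forall z \near e1, forall i,
    `|left_field G (delta_mx i 0) z - delta_mx i 0| <= k i * `|z - e1|.
  by apply: (@filter_forall _ _ _ (nbhs e1)) => i; have [] := kP i.
exists (n%:R * C + 1), (r / 2); split; first by rewrite ltr_wpDl// mulr_ge0// ltW.
  by rewrite divr_gt0.
move=> z w zr.
have zb : ball e1 r z.
  by rewrite -ball_normE /= distrC; apply: le_lt_trans zr _; rewrite ltr_pdivrMr//; lra.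
apply: (@le_trans _ _ (n%:R * (C * `|z - e1|) * `|w|)).
  apply: (@linear_basis_bound (fun w => left_field G w z - w)).
    by move=> c u v; rewrite left_field_lin scalerBr opprD addrACA.
  by move=> i; apply: le_trans (Hr _ zb i) _; rewrite ler_wpM2r.
by rewrite mulrA !ler_wpM2r// lerDl.
Qed.

(** Writing z s = z t c s with c t = 1, the factor [Ad (z t)] is a fixed linear map, and [Ad] of c s
    stays bounded on the basis vectors because each of these curves has a derivative at [t]. *)
Lemma Ad_bound_near a b t (z : R -> pt) u : a <= t <= b ->
  deriv_in a b z t (left_field G u (z t)) ->
  exists2 C : R, 0 < C & \forall s \near t, a <= s <= b ->
    forall w, `|Ad G (z s) w| <= C * `|w|.
Proof.
move=> tab zu.
have d1 := deriv_in_left1 tab zu.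
have [k k0 Hk] : exists2 k, 0 < k & forall v, `|Ad G (z t) v| <= k * `|v|.
  by apply: linear_cV_bound => c v w; rewrite AdD AdZ.
pose C := \sum_i (`|bracket G u (delta_mx i 0)| + 1 + `|delta_mx i 0 : pt|).
have C0 : 0 <= C by apply: sumr_ge0 => i _; rewrite !addr_ge0.
exists (k * (n%:R * C) + 1).
  by rewrite ltr_wpDl// mulr_ge0// ?mulr_ge0// ltW.
have H : \forall s \near t, forall i : 'I_n, a <= s <= b ->
    `|Ad G (gmul G (ginv G (z t)) (z s)) (delta_mx i 0) - delta_mx i 0| <=
    (`|bracket G u (delta_mx i 0)| + 1) * `|s - t|.
  apply: (@filter_forall _ _ _ (nbhs t)) => i.
  have := deriv_in_Ad1 (v := delta_mx i 0) tab (gmulV G _) d1.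
  by move=> /deriv_in_bound; rewrite gmulV Ad1.
apply: filterS2 H (near_dist t ltr01) => s H st sab w.
rewrite -[z s](gmulVKg G (z t)) AdM.
apply: le_trans (Hk _) _; rewrite mulrDl mul1r -mulrA.
apply: ler_wpDr => //; apply: ler_wpM2l; first exact: ltW.
apply: (@linear_basis_bound (Ad G _)).
  by move=> c v v'; rewrite AdD AdZ.
move=> i; rewrite -[Ad G _ _](subrK (delta_mx i 0)).
apply: le_trans (ler_normD _ _) _.
rewrite /C (bigD1 i)//=; apply: ler_wpDr.
  by apply: sumr_ge0 => j _; rewrite !addr_ge0.
apply: lerD => //; apply: le_trans (H i sab) _.
by rewrite ler_piMr ?addr_ge0// ltW.
Qed.

End Constants.

(** * The calibration inequality along one smooth arc *)

Section Calibration.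
Context {R : realType} {h m : nat} (G : carnot_group R h m).
Local Notation n := (h + m)%N.
Local Notation pt := ('cV[R]_n).
Local Notation e1 := (gone G).
Local Notation "x ** y" := (gmul G x y) (at level 40, left associativity).
Local Notation inv := (ginv G).
Implicit Types (u v W : 'cV[R]_h) (z p : pt).

Lemma padE k u v : pad (k *: u + v) = k *: pad u + pad v :> pt.
Proof. by rewrite /pad scale_col_mx scaler0 add_col_mx addr0. Qed.

Lemma frame_vecE k p z : frame_vec G (k *: p + z) = k *: frame_vec G p + frame_vec G z.
Proof.
rewrite -[LHS](left_field1 G) -[in RHS](left_field1 G (frame_vec G p)).
by rewrite -[in RHS](left_field1 G (frame_vec G z)) -!frame_mxE mulmxDr scalemxAr.
Qed.

Lemma dotv_pad p u : dotv p (pad u) = dotv (usubmx p) u.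
Proof.
rewrite /dotv big_split_ord /= [X in _ + X]big1 ?addr0.
  by apply: eq_bigr => i _; rewrite /pad col_mxEu mxE.
by move=> i _; rewrite pad_rshift mulr0.
Qed.

Lemma horizontal_coords z p : horizontal G z p ->
  coords G z p = pad (usubmx (coords G z p)).
Proof. by move=> H; rewrite -[LHS]vsubmxK H. Qed.

Lemma rnorm_horizontal z p : horizontal G z p ->
  rnorm G z p = enorm (usubmx (coords G z p)).
Proof.
move=> /horizontal_coords H; rewrite /rnorm /metric /enorm {1 2}H dotv_pad.
by rewrite /pad col_mxKu.
Qed.

Lemma horizontal_left_field z p : horizontal G z p ->
  p = left_field G (frame_vec G (pad (usubmx (coords G z p)))) z.
Proof. by move=> /horizontal_coords <-; rewrite left_field_coords. Qed.

(** With [W] the difference of horizontal velocities, [left_field G A z] is the velocity of [z]. If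
    the field is frozen at the identity, [momentum_Ad] gives exactly the pairing of [P_H] with [W];
    the rest is the error of [left_field_near1]. The second estimate controls the derivative of the
    squared distance of [z] to the identity. *)
Lemma calibration_constants x0 P0 r x P : 0 < r -> normal_geodesic G x0 P0 r x P ->
  exists B rho t1 : R, [/\ 0 < B, 0 < rho, 0 < t1, t1 <= r &
  forall tau z W, 0 <= tau <= t1 -> `|z - e1| <= rho ->
    let A := Ad G (x tau) (frame_vec G (pad W)) in
    momentum G x0 P0 (left_field G A z) <=
      dotv (usubmx (P tau)) W + B * `|z - e1| * enorm W /\
    `|dotv (z - e1) (left_field G A z)| <= B * `|z - e1| * enorm W].
Proof.
move=> r0 Hx.
have [C1 [rho [C10 rho0 H1]]] := left_field_near1 G.
have zr : 0 <= (0 : R) <= r by rewrite lexx ltW.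
have [C2 C20 /nbhs_ballP[d /= d0 H2]] := Ad_bound_near zr (normal_geodesic_deriv Hx zr).
have [C3 C30 H3] : exists2 k : R, 0 < k &
    forall W, `|frame_vec G (pad W)| <= k * `|W|.
  by apply: linear_cV_bound => k u v; rewrite padE frame_vecE.
have [C4 C40 H4] : exists2 k : R, 0 < k & forall v : pt, `|momentum G x0 P0 v| <= k * `|v|.
  by apply: linear_cV_bound => k u v; rewrite momentumD momentumZ.
pose t1 := Num.min r (d / 2).
pose K := C2 * C3.
(* One constant for both estimates: the first summand serves the momentum, the second the pairing
   with [z - e1]. *)
pose B := C4 * C1 * K + n%:R * (C1 * rho + 1) * K + 1.
have K0 : 0 < K by rewrite mulr_gt0.
have B1 : 0 <= C4 * C1 * K by rewrite !mulr_ge0// ltW.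
have B2 : 0 <= n%:R * (C1 * rho + 1) * K.
  by rewrite !mulr_ge0 ?addr_ge0 ?mulr_ge0// ltW.
exists B, rho, t1; split => //.
- by rewrite /B ltr_wpDl// addr_ge0.
- by rewrite lt_min r0 divr_gt0.
- by rewrite ge_min lexx.
move=> tau z W /andP[tau0 taut] zrho; set A := Ad _ _ _.
have taur : 0 <= tau <= r by rewrite tau0 (le_trans taut)// ge_min lexx.
have taud : tau <= d / 2 by rewrite (le_trans taut)// ge_min lexx orbT.
have AW : `|A| <= K * enorm W.
  have bt : ball (0 : R) d tau.
    rewrite -ball_normE /= sub0r normrN ger0_norm//.
    by apply: le_lt_trans taud _; rewrite ltr_pdivrMr//; lra.
  apply: le_trans (H2 _ bt taur _) _; rewrite -mulrA ler_wpM2l//; first exact: ltW.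
  apply: le_trans (H3 _) _; rewrite ler_wpM2l//; first exact: ltW.
  exact: norm_le_enorm.
have e0 : 0 <= enorm W by exact: sqrtr_ge0.
have LA := H1 z A zrho.
split.
  rewrite -[left_field G A z](subrK A) addrC momentumD.
  rewrite (momentum_Ad _ Hx taur) frame_vecK dotv_pad lerD2l.
  apply: le_trans (ler_norm _) _; apply: le_trans (H4 _) _.
  apply: (@le_trans _ _ (C4 * (C1 * `|z - e1| * (K * enorm W)))).
    apply: ler_wpM2l; first exact: ltW.
    by apply: le_trans LA _; rewrite ler_wpM2l// mulr_ge0// ltW.
  have -> : C4 * (C1 * `|z - e1| * (K * enorm W)) =
    C4 * C1 * K * (`|z - e1| * enorm W) by ring.
  by rewrite -[leRHS]mulrA ler_wpM2r ?mulr_ge0// /B; lra.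
apply: le_trans (dotv_norm_le _ _) _.
have LA' : `|left_field G A z| <= (C1 * rho + 1) * (K * enorm W).
  rewrite -[left_field G A z](subrK A); apply: le_trans (ler_normD _ _) _.
  rewrite mulrDl mul1r lerD//; apply: le_trans LA _.
  by apply: ler_pM => //; [rewrite mulr_ge0// ltW|rewrite ler_wpM2l// ltW].
apply: (@le_trans _ _ (n%:R * `|z - e1| * ((C1 * rho + 1) * (K * enorm W)))).
  by rewrite ler_wpM2l// mulr_ge0.
have -> : n%:R * `|z - e1| * ((C1 * rho + 1) * (K * enorm W)) =
  n%:R * (C1 * rho + 1) * K * (`|z - e1| * enorm W) by ring.
by rewrite -[leRHS]mulrA ler_wpM2r ?mulr_ge0// /B; lra.
Qed.

(** The geodesic is run at the rate at which [y] gains length, whence the factor [enorm v] in front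
    of [P_H]. *)
Lemma deriv_in_comparison x0 P0 r x P c d (y y' : R -> pt) tau t :
  normal_geodesic G x0 P0 r x P -> c <= t <= d ->
  (forall s, c <= s <= d -> 0 <= tau s <= r) ->
  horizontal G (y t) (y' t) -> deriv_in c d y t (y' t) ->
  deriv_in c d tau t (rnorm G (y t) (y' t)) ->
  let v := usubmx (coords G (y t) (y' t)) in
  let z := fun s => y s ** inv (x (tau s)) in
  deriv_in c d z t (left_field G (Ad G (x (tau t))
    (frame_vec G (pad (v - enorm v *: usubmx (P (tau t)))))) (z t)).
Proof.
move=> Hx tcd taur hy yy' dtau v z.
have E : frame_vec G (pad (v - enorm v *: usubmx (P (tau t)))) =
    frame_vec G (pad v) - enorm v *: hlift G (P (tau t)).
  rewrite /hlift addrC -scaleNr padE frame_vecE addrC scaleNr.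
  by [].
have dx := normal_geodesic_deriv Hx (taur t tcd).
have dxt := deriv_in_time tcd taur dtau dx.
rewrite E; apply: (deriv_in_quotient (z := x \o tau)) => //.
  by rewrite -horizontal_left_field.
rewrite -(rnorm_horizontal hy); move: dxt.
by rewrite /left_field diffZE.
Qed.

(** For [M * tau <= 1] the quadratic term is nonnegative, so a nonpositive defect bounds the
    momentum by 0. *)
Definition defect x0 P0 (M tau : R) z : R :=
  momentum G x0 P0 (z - e1) + (1 - M * tau) * dotv (z - e1) (z - e1).

(** Two invariants are carried along the arc. The bound on [q] keeps [z] in the ball of radius
    [rho], where the estimates apply; the sign of the defect then persists because its derivative is
    nonpositive. Both are stated with the elapsed length [tau], so that they pass from one arc to
    the next. *)
Lemma arc_calibration x0 P0 r x P (B rho t1 : R) c d y D tau :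
  normal_geodesic G x0 P0 r x P ->
  (forall t, 0 <= t <= r -> enorm (usubmx (P t)) = 1) ->
  0 < B -> 0 < rho -> t1 <= r -> 4 * B * t1 < rho -> 5 * B ^+ 2 * t1 <= 1 ->
  (forall tau z W, 0 <= tau <= t1 -> `|z - e1| <= rho ->
    let A := Ad G (x tau) (frame_vec G (pad W)) in
    momentum G x0 P0 (left_field G A z) <=
      dotv (usubmx (P tau)) W + B * `|z - e1| * enorm W /\
    `|dotv (z - e1) (left_field G A z)| <= B * `|z - e1| * enorm W) ->
  c <= d -> derivatives_in c d y D ->
  (forall t, c <= t <= d -> horizontal G (y t) (D 1%N t)) ->
  (forall t, c <= t <= d -> deriv_in c d tau t (rnorm G (y t) (D 1%N t))) ->
  0 <= tau c -> tau d <= t1 ->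
  let z := fun s => y s ** inv (x (tau s)) in
  let q := fun s => dotv (z s - e1) (z s - e1) in
  q c <= 4 * B * rho * tau c -> defect x0 P0 (5 * B ^+ 2) (tau c) (z c) <= 0 ->
  q d <= 4 * B * rho * tau d /\ defect x0 P0 (5 * B ^+ 2) (tau d) (z d) <= 0.
Proof.
move=> Hx Hu B0 rho0 t1r Bt1 Mt1 HB cd [D0 DS] hy dtau tauc taud z q qc Fc.
have taut t : c <= t <= d -> 0 <= tau t <= t1.
  move=> /andP[ct td]; rewrite (le_trans tauc) ?(le_trans _ taud)//;
    apply: (deriv_in_mono dtau) => // s _; exact: sqrtr_ge0.
have taur t : c <= t <= d -> 0 <= tau t <= r.
  by move=> /taut/andP[-> /= H]; exact: le_trans H t1r.
pose v t := usubmx (coords G (y t) (D 1%N t)).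
pose u t := usubmx (P (tau t)).
pose W t := v t - enorm (v t) *: u t.
pose l t := left_field G (Ad G (x (tau t)) (frame_vec G (pad (W t)))) (z t).
have yl t : c <= t <= d -> deriv_in c d y t (D 1%N t).
  by move=> tcd; apply: deriv_in_ext (DS 0%N t tcd).
have dz t : c <= t <= d -> deriv_in c d z t (l t).
  by move=> tcd; exact: deriv_in_comparison Hx tcd taur (hy t tcd) (yl t tcd) (dtau t tcd).
have dz1 t : c <= t <= d -> deriv_in c d (fun s => z s - e1) t (l t).
  move=> tcd; have := deriv_inD (dz t tcd) (deriv_in_cst c d (- e1) t).
  by rewrite addr0.
have dq t : c <= t <= d -> deriv_in c d q t (2 * dotv (z t - e1) (l t)).
  move=> tcd; have := deriv_in_dotv (dz1 t tcd) (dz1 t tcd).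
  by rewrite (dotvC (l t)) mulr_natl mulr2n.
have sE t : c <= t <= d -> rnorm G (y t) (D 1%N t) = enorm (v t).
  by move=> tcd; rewrite rnorm_horizontal//; exact: hy.
have uu t : c <= t <= d -> dotv (u t) (u t) = 1.
  by move=> tcd; rewrite -enorm_sqr Hu ?expr1n// taur.
(* Expand |v|^2 with v = W + |v| u and |u| = 1: this is the exact second order gain of the
   comparison. *)
have WW t : c <= t <= d ->
    enorm (W t) ^+ 2 = - 2 * enorm (v t) * dotv (u t) (W t).
  move=> tcd; rewrite enorm_sqr /W !dotvDr !dotvNr !dotvZr uu//.
  rewrite ![dotv (v t - _) _]dotvC !dotvDr !dotvNr !dotvZr uu// -!enorm_sqr.
  by rewrite [dotv (v t) (u t)]dotvC; ring.
have W2 t : c <= t <= d -> enorm (W t) <= 2 * enorm (v t).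
  move=> tcd; rewrite -ler_sqr ?nnegrE ?mulr_ge0 ?sqrtr_ge0//.
  have := dotv_ge0 (v t + enorm (v t) *: u t).
  rewrite WW// /W !dotvDr !dotvNr !dotvZr uu//.
  rewrite ![dotv (v t + _) _]dotvC !dotvDr !dotvZr uu// -!enorm_sqr.
  by rewrite [dotv (v t) (u t)]dotvC; nra.
have nq t : `|z t - e1| ^+ 2 <= q t by exact: norm_sqr_le.
have qrho t : c <= t <= d -> q t <= rho ^+ 2 -> `|z t - e1| <= rho.
  move=> tcd qr; rewrite -ler_sqr ?nnegrE ?(ltW rho0)//.
  exact: le_trans (nq t) qr.
have Brho : 0 < 4 * B * rho by rewrite !mulr_gt0.
have e0 : 0 < rho ^+ 2 - 4 * B * rho * t1.
  by rewrite expr2 -[4 * B * rho * t1]mulrA [rho * t1]mulrC mulrA -mulrBl mulr_gt0// subr_gt0.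
(* The slope [4 * B * rho] comes from q' <= 2 B |z - 1| |W| with |z - 1| <= rho and |W| <= 2 |v|,
   where |v| is the derivative of [tau]. The margin [e0] of the barrier is what remains below
   [rho ^+ 2] at [tau = t1]. *)
have qA t : c <= t <= d -> q t - 4 * B * rho * tau t <= 0.
  move=> /andP[ct td].
  have sub s : c <= s <= t -> c <= s <= d.
    by move=> /andP[-> st]; exact: le_trans st td.
  apply: (@barrier _ c t _ (fun s => q s - 4 * B * rho * tau s)
    (fun s => 2 * dotv (z s - e1) (l s) - 4 * B * rho * enorm (v s)) e0 ct).
  - move=> s /sub scd.
    have := deriv_in_scale (deriv_in_cst c d (- (4 * B * rho)) s) (dtau s scd).
    rewrite scale0r add0r sE// => /(deriv_inD (dq s scd)) /(deriv_in_sub (lexx c) td).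
    by rewrite [- _ *: _]mulNr; under eq_fun do rewrite [- _ *: _]mulNr.
  - by rewrite subr_le0.
  move=> s /sub scd fs.
  have qs : q s <= rho ^+ 2.
    have : 4 * B * rho * tau s <= 4 * B * rho * t1.
      by apply: ler_wpM2l; [exact: ltW|have /andP[] := taut s scd].
    by lra.
  have zs := qrho s scd qs.
  have [_ H] := HB (tau s) (z s) (W s) (taut s scd) zs.
  have : `|z s - e1| * enorm (W s) <= rho * (2 * enorm (v s)).
    by rewrite ler_pM ?sqrtr_ge0// W2.
  have := le_trans (ler_norm _) H; rewrite -/(l s) -mulrA => H' H''.
  have := ler_wpM2l (ltW B0) H''; lra.
have zrho t : c <= t <= d -> `|z t - e1| <= rho.
  move=> tcd; apply: qrho => //; have := qA t tcd.
  have : 4 * B * rho * tau t <= 4 * B * rho * t1.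
    by apply: ler_wpM2l; [exact: ltW|have /andP[] := taut t tcd].
  by lra.
split; first by have := qA d; rewrite lexx cd => /(_ isT); lra.
apply: le_trans Fc.
(* Any [M >= (3 B)^2 / 2] makes the quadratic form below nonpositive. *)
pose M := 5 * B ^+ 2.
apply: (@deriv_in_le _ c d (fun t => defect x0 P0 M (tau t) (z t))
  (fun t => momentum G x0 P0 (l t) +
   (- (M * enorm (v t)) * q t + (1 - M * tau t) * (2 * dotv (z t - e1) (l t))))) => // t tcd.
  have L : linear (momentum G x0 P0).
    by move=> k a b; rewrite momentumD momentumZ.
  have d1 := deriv_in_linear L tcd (dz1 t tcd).
  have d2 := deriv_inD (deriv_in_cst c d (1 : R) t)
    (deriv_in_scale (deriv_in_cst c d (- M) t) (dtau t tcd)).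
  have := deriv_inD d1 (deriv_in_scale d2 (dq t tcd)).
  rewrite scale0r !add0r sE// [- M *: _]mulNr [- M *: _]mulNr.
  by apply: deriv_in_ext => // s _; rewrite /defect [- M *: _]mulNr.
have [H1 H2] := HB (tau t) (z t) (W t) (taut t tcd) (zrho t tcd).
rewrite -/(l t) in H1 H2.
have {}H2 := le_trans (ler_norm _) H2.
have nqt := nq t; have WWt := WW t tcd; have W2t := W2 t tcd.
have a0 : 0 <= enorm (W t) := sqrtr_ge0 _.
have s0 : 0 <= enorm (v t) := sqrtr_ge0 _.
have Mtau : 0 <= 1 - M * tau t <= 1.
  have M0 : 0 <= M by rewrite mulr_ge0// sqr_ge0.
  have /andP[t0 tt1] := taut t tcd.
  have := ler_wpM2l M0 tt1; have := mulr_ge0 M0 t0.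
  by move: Mt1; rewrite -/M; lra.
(* At a time where the velocity vanishes, [WW] says nothing about this pairing; the present bound
   shows that it is then nonpositive. *)
have uW : dotv (usubmx (P (tau t))) (W t) <= h%:R * `|u t| * enorm (W t).
  apply: le_trans (ler_norm _) _; apply: le_trans (dotv_norm_le _ _) _.
  by rewrite ler_wpM2l ?mulr_ge0// norm_le_enorm.
rewrite /u in WWt.
have p0 := normr_ge0 (z t - e1).
move: (momentum _ _ _ _) (dotv (z t - e1) (l t)) (dotv (usubmx _) _) H1 H2 uW WWt => mo dl g.
move: (`|z t - e1|) (q t) (enorm (W t)) (enorm (v t)) nqt W2t a0 s0 p0 => p Q a s.
move=> pQ a2 a0 s0 p0 H1 H2 uW WWt.
have K1 : (1 - M * tau t) * (2 * dl) <= 2 * (B * p * a).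
  have Bpa : 0 <= B * p * a by rewrite !mulr_ge0// ltW.
  have /andP[k0 k1] := Mtau.
  apply: (@le_trans _ _ ((1 - M * tau t) * (2 * (B * p * a)))).
    by rewrite ler_wpM2l//; lra.
  by rewrite ler_piMl// mulr_ge0.
have K2 : M * s * p ^+ 2 <= M * s * Q.
  by rewrite ler_wpM2l// mulr_ge0// mulr_ge0// sqr_ge0.
(* One error [B * p * a] comes from the momentum, two from the derivative of the squared norm. *)
suff : g + 3 * (B * p * a) - M * s * p ^+ 2 <= 0 by lra.
have [s_0|s_gt0] := eqVneq s 0.
  have a_0 : a = 0 by apply/eqP; rewrite eq_le a0 andbT; lra.
  by move: uW; rewrite s_0 a_0 !mulr0 mul0r; lra.
have {s_gt0} s1 : 0 < s by rewrite lt_neqAle eq_sym s_gt0.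
(* After multiplication by [s], [WW] turns [s * g] into - a^2 / 2 and the expression becomes a
   quadratic form in [a] and [p * s]. *)
rewrite -(pmulr_rle0 _ s1) /M.
have -> : s * (g + 3 * (B * p * a) - 5 * B ^+ 2 * s * p ^+ 2) =
  - (1 / 2) * (a - 3 * B * p * s) ^+ 2 - (1 / 2) * (B * p * s) ^+ 2.
  have -> : s * (g + 3 * (B * p * a) - 5 * B ^+ 2 * s * p ^+ 2) =
    s * g + 3 * B * p * s * a - 5 * (B * p * s) ^+ 2 by ring.
  have -> : s * g = - (1 / 2) * a ^+ 2 by rewrite WWt; field.
  by field.
have := sqr_ge0 (a - 3 * B * p * s); have := sqr_ge0 (B * p * s); lra.
Qed.

End Calibration.

(** * Piecewise smooth horizontal curves *)

Section PiecewisePaths.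
Context {R : realType} {h m : nat} (G : carnot_group R h m).
Local Notation n := (h + m)%N.
Local Notation pt := ('cV[R]_n).
Local Notation e1 := (gone G).
Local Notation "x ** y" := (gmul G x y) (at level 40, left associativity).
Local Notation inv := (ginv G).
Implicit Types (y w : R -> pt) (a b c d : R).

(** The subdivision of [pw_smooth_horizontal] in a form that allows induction on the number of
    arcs. *)
Inductive pw_path y : R -> R -> Prop :=
| pw_nil a : pw_path y a a
| pw_cons a c b : a < c -> smooth_horizontal_arc G a c y -> pw_path y c b ->
    pw_path y a b.

Lemma pw_pathP a b y : pw_smooth_horizontal G a b y <-> pw_path y a b.
Proof.
split.
  move=> [s]; elim: s a => [|c s IH] a [/= ps [lb H]].
    by rewrite -lb; exact: pw_nil.
  have /andP[ac cs] := ps.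
  apply: (@pw_cons _ _ c) => //; first exact: (H 0%N).
  apply: IH; split => //; split => // i si.
  have := H i.+1 si; rewrite /= => K.
  have E : nth a (c :: s) i = nth c (c :: s) i by apply: set_nth_default; exact: leqW.
  have E' : nth a s i = nth c s i by apply: set_nth_default.
  by rewrite -E -E'.
elim=> [{}a|{}a c {}b ac arc _ [s [ps [ls H]]]].
  by exists [::]; split.
exists (c :: s); split; first by rewrite /= ac.
split => // -[|i] si //=.
have E : nth a (c :: s) i = nth c (c :: s) i by apply: set_nth_default; exact: leqW.
have E' : nth a s i = nth c s i by apply: set_nth_default.
by move: E => /= ->; rewrite E'; apply: H.
Qed.

Lemma pw_path_le a b y : pw_path y a b -> a <= b.
Proof. by elim=> // {}a c {}b ac _ _; apply: le_trans; exact: ltW. Qed.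

Lemma pw_path_snoc a b c y : pw_path y a b -> b < c ->
  smooth_horizontal_arc G b c y -> pw_path y a c.
Proof.
move=> yab bc arc; elim: yab bc arc => [{}a ac arc|{}a d {}b ad arc _ IH bc arc'].
  exact: pw_cons ac arc (pw_nil _ _).
exact: pw_cons ad arc (IH bc arc').
Qed.

Lemma smooth_arc_ext a b y w : (forall t, a <= t <= b -> y t = w t) ->
  smooth_horizontal_arc G a b y -> smooth_horizontal_arc G a b w.
Proof.
move=> yw [D [D0 DS] hD]; exists D; last by move=> t tab; rewrite -yw//; exact: hD.
by split; [move=> t tab; rewrite D0//; exact: yw|exact: DS].
Qed.

Lemma pw_path_ext a b y w : (forall t, a <= t <= b -> y t = w t) ->
  pw_path y a b -> pw_path w a b.
Proof.
move=> yw yab; elim: yab yw => [{}a _|{}a c {}b ac arc cb IH yw]; first exact: pw_nil.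
have cb' := pw_path_le cb.
apply: (pw_cons ac).
  by apply: smooth_arc_ext arc => t /andP[t1 t2]; rewrite yw// t1 (le_trans t2).
by apply: IH => t /andP[t1 t2]; rewrite yw// t2 (le_trans (ltW ac)).
Qed.

(** A relation between elapsed length and position that survives each smooth arc survives the whole
    curve. The starting length [tau] is universally quantified so that the induction can restart
    after the first arc. The trivial relation yields finiteness of the length. *)
Lemma pw_path_state a b y (T : R -> pt -> Prop) (t1 : R) :
  (forall c d D tau, c < d -> derivatives_in c d y D ->
    (forall t, c <= t <= d -> horizontal G (y t) (D 1%N t)) ->
    (forall t, c <= t <= d -> deriv_in c d tau t (rnorm G (y t) (D 1%N t))) ->
    0 <= tau c -> tau d <= t1 -> T (tau c) (y c) -> T (tau d) (y d)) ->
  pw_path y a b ->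
  measurable_fun `[a, b] (fun t => rnorm G (y t) (derive1 y t)) /\
  exists L : R, [/\ 0 <= L, curve_length G a b y = L%:E &
    forall tau, 0 <= tau -> tau + L <= t1 -> T tau (y a) -> T (tau + L) (y b)].
Proof.
move=> HT; elim=> [{}a|{}a c {}b ac [D Dy hD] cb [m2 [L2 [L20 E2 T2]]]].
  split; first by rewrite set_itv1; exact: measurable_fun_set1.
  exists 0; split => // [|tau _ _]; last by rewrite addr0.
  by rewrite /curve_length set_itv1 integral_set1.
have [m1 [Lf [Lc E1] dL]] := arc_length G ac Dy.
have [mab Eab] := curve_length_cat (ltW ac) (pw_path_le cb) m1 m2.
split => //; exists (Lf c + L2).
have L1 : 0 <= Lf c by have := curve_length_ge0 G a c y; rewrite E1 lee_fin.
split; [exact: addr_ge0|by rewrite Eab E1 E2 EFinD|].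
move=> tau tau0 taut Ta; rewrite addrA; apply: T2; rewrite ?addr_ge0// -?addrA//.
have := HT a c D (fun t => tau + Lf t) ac Dy hD; rewrite Lc addr0; apply => //.
  move=> t tac; have := deriv_inD (deriv_in_cst a c tau t) (dL t tac).
  by rewrite add0r.
by apply: le_trans taut; rewrite lerD2l lerDl.
Qed.

Lemma pw_path_length a b y : pw_path y a b ->
  measurable_fun `[a, b] (fun t => rnorm G (y t) (derive1 y t)) /\
  exists2 L : R, 0 <= L & curve_length G a b y = L%:E.
Proof.
move=> yab; have [//|? [L [? ? _]]] := @pw_path_state a b y (fun _ _ => True) 0 _ yab.
by split => //; exists L.
Qed.

(* Comparing a curve issued from [x0] with the geodesic at the time equal to the
   length travelled: this says that the geodesic is optimal to first order in the
   direction of its momentum. *)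
Lemma calibration x0 P0 r x P : 0 < r -> normal_geodesic G x0 P0 r x P ->
  (forall t, 0 <= t <= r -> enorm (usubmx (P t)) = 1) ->
  exists2 t1 : R, 0 < t1 <= r & forall a b y (L : R), pw_path y a b -> y a = x0 ->
    curve_length G a b y = L%:E -> L <= t1 ->
    momentum G x0 P0 (y b ** inv (x L) - e1) <= 0.
Proof.
move=> r0 Hx Hu.
have [B [rho [t2 [B0 rho0 t20 t2r HB]]]] := calibration_constants r0 Hx.
(* The second bound gives [4 * B * t1 <= rho / 2], which leaves room for the barrier; the third
   keeps the weight of the quadratic term nonnegative. *)
pose t1 := Num.min t2 (Num.min (rho / (8 * B)) ((5 * B ^+ 2)^-1)).
have B2 : 0 < 5 * B ^+ 2 by rewrite mulr_gt0// exprn_gt0.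
have t10 : 0 < t1 by rewrite !lt_min t20 divr_gt0 ?mulr_gt0//= invr_gt0.
have t12 : t1 <= t2 by rewrite ge_min lexx.
have t1r : t1 <= r by exact: le_trans t12 t2r.
have t1rho : 4 * B * t1 < rho.
  have : t1 <= rho / (8 * B) by rewrite !ge_min lexx orbT.
  by rewrite ler_pdivlMr ?mulr_gt0//; lra.
have t1B : 5 * B ^+ 2 * t1 <= 1.
  have : t1 <= (5 * B ^+ 2)^-1 by rewrite !ge_min lexx !orbT.
  by rewrite -(ler_pM2l B2) mulfV// gt_eqF.
have HB' tau z W : 0 <= tau <= t1 -> `|z - e1| <= rho ->
    let A := Ad G (x tau) (frame_vec G (pad W)) in
    momentum G x0 P0 (left_field G A z) <=
      dotv (usubmx (P tau)) W + B * `|z - e1| * enorm W /\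
    `|dotv (z - e1) (left_field G A z)| <= B * `|z - e1| * enorm W.
  by move=> /andP[H1 H2]; apply: HB; rewrite H1 (le_trans H2).
exists t1; first by rewrite t10.
move=> a b y L yab ya EL Lt1.
pose T tau q := let z := q ** inv (x tau) in
  dotv (z - e1) (z - e1) <= 4 * B * rho * tau /\
  defect G x0 P0 (5 * B ^+ 2) tau z <= 0.
have [|_ [L' [L0 EL' HT]]] := @pw_path_state a b y T t1 _ yab.
  move=> c d D tau cd Dy hy dtau tc td [qc Fc].
  exact: (arc_calibration Hx Hu B0 rho0 t1r t1rho t1B HB' (ltW cd) Dy hy dtau tc td).
have LL : L' = L by move: EL'; rewrite EL => -[].
have [x00 _ _] := Hx.
have z0 : momentum G x0 P0 0 = 0 by rewrite -[0](scale0r 0) momentumZ mul0r.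
have [||] := HT 0 (lexx 0).
- by rewrite add0r LL.
- rewrite /T x00 ya gmulgV /defect subrr z0 mulr0 add0r mulr0.
  have -> : dotv (0 : pt) 0 = 0 by rewrite /dotv big1// => i _; rewrite mxE mulr0.
  by rewrite mulr0.
rewrite add0r LL => qb; rewrite /defect => Fb.
have := dotv_ge0 (y b ** inv (x L) - e1).
have : 0 <= 1 - 5 * B ^+ 2 * L.
  rewrite subr_ge0; apply: le_trans t1B; rewrite ler_wpM2l//; exact: ltW.
move=> H1 H2; have := mulr_ge0 H1 H2; lra.
Qed.

End PiecewisePaths.

(** * Smoothness of geodesics and concatenation *)

Section Bootstrap.
Context {R : realType} {h m : nat} (G : carnot_group R h m).
Local Notation n := (h + m)%N.
Local Notation pt := ('cV[R]_n).
Local Notation S := ((pt * pt)%type).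

(** The geodesic equations as one autonomous smooth system for the pair of position and covector. *)
Definition geodesic_field (q : S) : S :=
  (left_field G (hlift G q.2) q.1, - (CV G (dsubmx q.2) *m pad (usubmx q.2))).

Lemma is_diff_fst (q : S) : is_diff q (fst : S -> pt) fst.
Proof.
have fc : continuous (fst : {linear S -> pt}) by move=> z; exact: cvg_fst.
by apply: DiffDef; [exact: linear_differentiable|exact: diff_lin].
Qed.

Lemma is_diff_snd (q : S) : is_diff q (snd : S -> pt) snd.
Proof.
have fc : continuous (snd : {linear S -> pt}) by move=> z; exact: cvg_snd.
by apply: DiffDef; [exact: linear_differentiable|exact: diff_lin].
Qed.

Lemma smooth_snd_linear (f : pt -> R) : linear f -> smooth (fun q : S => f q.2).
Proof.
move=> L k; pose Lm := GRing.isLinear.Build _ _ _ _ f L.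
pose LL : {linear 'cV[R]_n -> R} := HB.pack f Lm.
apply: (Ck_precomp is_diff_snd).
exact: (@Ck_linear _ _ _ _ LL (@linear_cV_continuous _ _ _ LL)).
Qed.

Lemma smooth_field1 J : smooth (fun q => (geodesic_field q).1 J 0).
Proof.
move=> k; apply: (@Ck_ext _ _ _ _ (fun q : S => \sum_I pad (usubmx q.2) I 0 *
    left_field G (cframe G I) q.1 J 0)).
  have lfZ c v z : left_field G (c *: v) z = c *: left_field G v z.
    by rewrite /left_field diffZE.
  move=> q; rewrite /= /hlift left_field_sum summxE; apply: eq_bigr => I _.
  by rewrite lfZ [RHS]mxE.
apply: Ck_sum => I; apply: CkM.
  apply: (@smooth_snd_linear (fun p => pad (usubmx p) I 0)) => c u v.
  by rewrite linearP padE !mxE.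
apply: Ck_coord; apply: (Ck_precomp is_diff_fst); exact: left_field_smooth.
Qed.

Lemma smooth_field2 J : smooth (fun q => (geodesic_field q).2 J 0).
Proof.
move=> k; apply: (@Ck_ext _ _ _ _ (fun q : S => \sum_K \sum_(a < m)
    (- Cmx G (rshift h a) J K) * (q.2 (rshift h a) 0 * pad (usubmx q.2) K 0))).
  move=> q; rewrite /= mxE mxE -sumrN; apply: eq_bigr => K _.
  rewrite /CV summxE mulr_suml -sumrN; apply: eq_bigr => a _.
  by rewrite !mxE; ring.
apply: Ck_sum => K; apply: Ck_sum => a; apply: CkM; first exact: Ck_cst.
apply: CkM.
  by apply: (@smooth_snd_linear (fun p => p (rshift h a) 0)) => c u v; rewrite !mxE.
apply: (@smooth_snd_linear (fun p => pad (usubmx p) K 0)) => c u v.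
by rewrite linearP padE !mxE.
Qed.

Definition field_derivative (f : S -> R) (q : S) : R := 'd f q (geodesic_field q).

Lemma smooth_field_derivative f : smooth f -> smooth (field_derivative f).
Proof.
move=> sf k; apply: (@Ck_ext _ _ _ _ (fun q : S =>
  \sum_J (geodesic_field q).1 J 0 * 'd f q (delta_mx J 0, 0) +
  \sum_J (geodesic_field q).2 J 0 * 'd f q (0, delta_mx J 0))).
  move=> q; rewrite /field_derivative; case: (geodesic_field q) => u v /=.
  have -> : (u, v) = (\sum_J u J 0 *: ((delta_mx J 0, 0) : S)) +
      \sum_J v J 0 *: ((0, delta_mx J 0) : S).
    rewrite [in LHS](cV_decomp u) [in LHS](cV_decomp v).
    have inlD : {morph (fun v => (v, 0) : S) : x y / x + y}.
      by move=> x y; apply/injective_projections; rewrite /= ?addr0.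
    have inrD : {morph (fun v => (0, v) : S) : x y / x + y}.
      by move=> x y; apply/injective_projections; rewrite /= ?addr0.
    have -> : (\sum_J u J 0 *: delta_mx J 0, \sum_J v J 0 *: delta_mx J 0) =
      (\sum_J u J 0 *: delta_mx J 0, 0) + (0, \sum_J v J 0 *: delta_mx J 0) :> S.
      by apply/injective_projections; rewrite /= ?addr0 ?add0r.
    rewrite (big_morph _ inlD erefl) (big_morph _ inrD erefl).
    by congr (_ + _); apply: eq_bigr => J _; apply/injective_projections;
      rewrite /= ?scaler0.
  rewrite diffDE !linear_sum; congr (_ + _); apply: eq_bigr => J _;
    by rewrite diffZE.
apply: CkD; apply: Ck_sum => J; apply: CkM.
- exact: smooth_field1.
- exact: smooth_diff.
- exact: smooth_field2.
- exact: smooth_diff.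
Qed.

(** The curves that compete in [ccdist] consist of smooth arcs, while a normal geodesic is only
    given as differentiable once. Along a solution, the derivative of [f (y, P)] is
    [field_derivative f] at the same point, so the derivatives of all orders are iterated Lie
    derivatives of the coordinates, up to the endpoints. *)
Lemma geodesic_smooth_arc a b (y P : R -> pt) : a < b ->
  (forall t, a <= t <= b -> deriv_in a b y t (left_field G (hlift G (P t)) (y t)) /\
     deriv_in a b P t (- (CV G (dsubmx (P t)) *m pad (usubmx (P t))))) ->
  exists2 D, derivatives_in a b y D &
    forall t, a <= t <= b -> D 1%N t = left_field G (hlift G (P t)) (y t).
Proof.
move=> ab H.
pose f k i := iter k field_derivative (fun q : S => q.1 i 0).
have sf k i : smooth (f k i).
  elim: k => [|k IH]; last exact: smooth_field_derivative.
  move=> k; apply: Ck_coord.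
  by apply: (@Ck_linear _ _ _ _ (fst : {linear S -> pt})) => z; exact: cvg_fst.
pose D k t : pt := \col_i f k i (y t, P t).
have DD : derivatives_in a b y D.
  split; first by move=> t _; apply/matrixP => i j; rewrite (ord1 j) mxE.
  move=> k t tab; apply: deriv_in_col => i; rewrite mxE.
  have [Hy HP] := H t tab.
  have := deriv_in_comp tab (smooth_differentiable (y t, P t) (sf k i))
    (deriv_in_pair Hy HP).
  by apply: deriv_in_ext => // s _; rewrite mxE.
exists D => // t tab; have [D0 DS] := DD.
apply: (deriv_in_unique ab tab _ (H t tab).1).
exact: (deriv_in_ext tab D0 (DS 0%N t tab)).
Qed.

End Bootstrap.

(** * Prolonging a curve by a translated arc of the geodesic *)

Section Concatenation.
Context {R : realType} {h m : nat} (G : carnot_group R h m).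
Local Notation n := (h + m)%N.
Local Notation pt := ('cV[R]_n).
Local Notation "x ** y" := (gmul G x y) (at level 40, left associativity).
Local Notation inv := (ginv G).

Lemma coords_hlift (z p : pt) :
  coords G z (left_field G (hlift G p) z) = pad (usubmx p).
Proof. by rewrite /hlift coords_left_field. Qed.

Lemma geodesic_translate x0 P0 r x P (s t b : R) (g : pt) :
  normal_geodesic G x0 P0 r x P ->
  (forall t, 0 <= t <= r -> enorm (usubmx (P t)) = 1) ->
  0 <= s -> s < t -> t <= r ->
  let y := fun u => g ** x (u - b + s) in
  smooth_horizontal_arc G b (b + (t - s)) y /\
  curve_length G b (b + (t - s)) y = (t - s)%:E.
Proof.
move=> Hx Hu s0 st tr y; set e := b + (t - s).
have be : b < e by rewrite /e ltrDl subr_gt0.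
pose tau (u : R) := u - b + s.
have taur u : b <= u <= e -> 0 <= tau u <= r by rewrite /tau /e => /andP[? ?]; lra.
have dtau u : deriv_in b e tau u 1.
  have := deriv_inD (deriv_inD (deriv_in_id b e u) (deriv_in_cst b e (- b) u))
    (deriv_in_cst b e s u).
  by rewrite !addr0.
have Hy u : b <= u <= e ->
  deriv_in b e y u (left_field G (hlift G (P (tau u))) (y u)) /\
  deriv_in b e (P \o tau) u (- (CV G (dsubmx (P (tau u))) *m pad (usubmx (P (tau u))))).
  move=> ube; have dx := normal_geodesic_deriv Hx (taur u ube).
  have [_ _ /(_ _ (taur u ube)) [_ dP]] := Hx.
  have := deriv_in_time ube taur (dtau u) dx; rewrite scale1r => d1.
  have := deriv_in_time ube taur (dtau u) dP; rewrite scale1r => d2.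
  by split; [exact: (deriv_in_left ube d1)|exact: d2].
have [D DD D1] := geodesic_smooth_arc (P := P \o tau) be Hy.
have hD u : b <= u <= e -> horizontal G (y u) (D 1%N u).
  by move=> ube; rewrite /horizontal D1// coords_hlift /pad col_mxKd.
split; first by exists D.
have [_ [L [Lb ->] dL]] := arc_length G be DD.
congr (_%:E).
(* The speed is 1, so length minus parameter is constant. *)
have := @deriv_in_const R b e (fun u => L u + (-1) *: u) _ e.
rewrite Lb (ltW be) lexx => H; have : forall u, b <= u <= e ->
    deriv_in b e (fun u => L u + (-1) *: u) u 0.
  move=> u ube; have := deriv_inD (dL u ube)
    (deriv_in_scale (deriv_in_cst b e (-1 : R) u) (deriv_in_id b e u)).
  rewrite (rnorm_horizontal (hD u ube)) (D1 u ube) coords_hlift /pad col_mxKu.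
  rewrite Hu ?taur//.
  by rewrite scale0r add0r [_ *: 1]mulr1 subrr.
by move=> /H /(_ isT); rewrite /e ![_ *: _]mulN1r; lra.
Qed.

Lemma curve_length_ext a b (y w : R -> pt) :
  (forall t, a <= t <= b -> y t = w t) ->
  pw_path G y a b -> curve_length G a b y = curve_length G a b w.
Proof.
move=> yw yab; have wab := pw_path_ext yw yab.
have [my _] := pw_path_length yab; have [mw _] := pw_path_length wab.
have sub : `]a, b[%classic `<=` `[a, b]%classic by exact: subset_itv_oo_cc.
rewrite /curve_length integral_itv_bndoo; last first.
  by apply/measurable_EFinP; apply: measurable_funS my.
rewrite [RHS]integral_itv_bndoo; last first.
  by apply/measurable_EFinP; apply: measurable_funS mw.
apply: eq_integral => t; rewrite inE /= in_itv/= => /andP[ta tb].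
have tab : a <= t <= b by rewrite !ltW.
have -> : derive1 y t = derive1 w t; last by rewrite (yw t tab).
rewrite !derive1E; apply: near_eq_derive.
have m0 : 0 < Num.min (t - a) (b - t) by rewrite lt_min !subr_gt0 ta.
apply: filterS (near_dist t m0) => u; rewrite lt_min !ltr_distl => H.
by apply: yw; lra.
Qed.

(** Follow [y] and then the left translate of the arc of [x] between [s] and [t] that starts at
    [y b]; left translations preserve horizontality and length. *)
Lemma ccdist_le_tail x0 P0 r x P (s t L a b : R) (y : R -> pt) :
  normal_geodesic G x0 P0 r x P ->
  (forall t, 0 <= t <= r -> enorm (usubmx (P t)) = 1) ->
  0 <= s -> s < t -> t <= r ->
  pw_path G y a b -> curve_length G a b y = L%:E ->
  (ccdist G (y a) (y b ** inv (x s) ** x t) <= (L + (t - s))%:E)%E.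
Proof.
move=> Hx Hu s0 st tr yab EL.
have [arc EL'] := geodesic_translate b (y b ** inv (x s)) Hx Hu s0 st tr.
set e := b + (t - s) in arc EL'.
set z := fun u => _ in arc EL'.
have be : b < e by rewrite /e ltrDl subr_gt0.
have ab := pw_path_le yab.
pose w u := if u <= b then y u else z u.
have yw u : a <= u <= b -> y u = w u by rewrite /w => /andP[_ ->].
have zb : z b = y b by rewrite /z subrr add0r -gmulA gmulV gmulg1.
have zw u : b <= u <= e -> z u = w u.
  rewrite /w le_eqVlt => /andP[/predU1P[<- _|bu _]]; first by rewrite lexx zb.
  by rewrite leNgt bu.
have wab := pw_path_ext yw yab.
have zarc : pw_path G z b e by apply: pw_cons be arc (pw_nil _ _ _).
have wae := pw_path_snoc wab be (smooth_arc_ext zw arc).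
have [mw _] := pw_path_length wab.
have [mz _] := pw_path_length (pw_path_ext zw zarc).
have [_ E] := curve_length_cat ab (ltW be) mw mz.
rewrite -(curve_length_ext yw yab) -(curve_length_ext zw zarc) EL EL' in E.
apply: ereal_inf_lbound; exists a, e, w; split; first exact/pw_pathP.
split; first by rewrite -yw// lexx.
split; last by rewrite E EFinD.
have bee : b <= e <= e by rewrite (ltW be) lexx.
rewrite -(zw e bee).
by rewrite /z /e [b + _]addrC addrK subrK.
Qed.

End Concatenation.

(** * The gradient of the distance along a geodesic *)

Section Extrema.
Context {R : realType}.

Lemma deriv_in_max (d : R) (f : R -> R) (l : R) : 0 < d ->
  deriv_in (- d) d f 0 l -> (forall s, - d <= s <= d -> f s <= f 0) -> l = 0.
Proof.
move=> d0 /deriv_inP H fmax; apply/eqP; rewrite -normr_le0 leNgt; apply/negP => l0.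
have e0 : 0 < `|l| / 2 by rewrite divr_gt0.
have /nbhs_ballP[k /= k0 Hk] := H _ e0.
(* A step in the direction in which [f] would increase at the rate [|l|]. *)
pose s := Num.sg l * (Num.min d k / 2).
have m0 : 0 < Num.min d k by rewrite lt_min d0.
have sgl : `|Num.sg l| = 1 by rewrite normr_sg -normr_gt0 l0.
have sE : `|s| = Num.min d k / 2.
  by rewrite normrM sgl mul1r gtr0_norm// divr_gt0.
have md : Num.min d k <= d by rewrite ge_min lexx.
have mk : Num.min d k <= k by rewrite ge_min lexx orbT.
have sd : `|s| < d by rewrite sE ltr_pdivrMr//; lra.
have sk : `|s| < k by rewrite sE ltr_pdivrMr//; lra.
have sdd : - d <= s <= d by rewrite -ler_norml ltW.
have bs : ball (0 : R) k s by rewrite -ball_normE /= sub0r normrN.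
have := Hk s bs sdd; rewrite subr0 => K.
have sl : s *: l = `|s| * `|l|.
  by rewrite sE [_ *: _]mulrAC -normrEsg mulrC.
have := fmax s sdd; move: K; rewrite sl ler_norml => /andP[K _] K'.
have s0 : 0 < `|s| by rewrite sE divr_gt0.
have := mulr_gt0 s0 l0; lra.
Qed.

Lemma deriv_in_line (V : normedModType R) (a b : R) (p v : V) (t : R) :
  deriv_in a b (fun s => p + s *: v) t v.
Proof.
have := deriv_inD (deriv_in_cst a b p t)
  (deriv_in_scale (deriv_in_id a b t) (deriv_in_cst a b v t)).
by rewrite scaler0 addr0 scale1r add0r.
Qed.

End Extrema.

Section Distance.
Context {R : realType} {h m : nat} (G : carnot_group R h m).
Local Notation n := (h + m)%N.
Local Notation pt := ('cV[R]_n).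
Local Notation e1 := (gone G).
Local Notation "x ** y" := (gmul G x y) (at level 40, left associativity).
Local Notation inv := (ginv G).
Implicit Types (p q v w : pt).

Lemma ccdist_ge0 p q : (0 <= ccdist G p q)%E.
Proof.
apply: le_ereal_inf_tmp => _ [a [b [g [_ [_ [_ ->]]]]]]; exact: curve_length_ge0.
Qed.

Lemma dc_le p q (L : R) : (ccdist G p q <= L%:E)%E -> dc G p q <= L.
Proof.
move=> H; have := ccdist_ge0 p q; rewrite /dc; move: H.
by case: (ccdist G p q) => //= s; rewrite lee_fin.
Qed.

Lemma near_minimizer p q (e : R) : 0 < dc G p q -> 0 < e ->
  exists a b y (L : R), [/\ pw_path G y a b, y a = p, y b = q,
    curve_length G a b y = L%:E & dc G p q <= L < dc G p q + e].
Proof.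
move=> d0 e0.
(* [fine] takes the value 0 at infinity, so a positive [dc] certifies that the distance is
   finite. *)
have fin : ccdist G p q = (dc G p q)%:E.
  by move: d0; rewrite /dc; case: (ccdist G p q) => //=; rewrite ltxx.
have fin' : ccdist G p q \is a fin_num by rewrite fin.
have [_ [a [b [y [/pw_pathP yab [ya [yb ->]]]]]]] := lb_ereal_inf_adherent e0 fin'.
have [_ [L L0 EL]] := pw_path_length yab.
rewrite -/(ccdist G p q) fin EL lte_fin => Le.
exists a, b, y, L; split => //; rewrite Le andbT -lee_fin -fin -EL.
by apply: ereal_inf_lbound; exists a, b, y; split; [exact/pw_pathP|].
Qed.

Lemma diff_grad (f : pt -> R) q v :
  'd f q (left_field G v q) = dotv (grad G f q) (frame_coord G v).
Proof.
rewrite -{1}(frame_coordK G v) left_field_sum linear_sum /dotv.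
apply: eq_bigr => J _.
have -> : grad G f q J 0 = 'd f q (left_field G (cframe G J) q) by rewrite mxE.
move: (frame_coord G v J 0) => c; rewrite mulrC.
have -> : left_field G (c *: cframe G J) q = c *: left_field G (cframe G J) q.
  by rewrite /left_field diffZE.
by rewrite diffZE.
Qed.

Lemma left_field0 q : left_field G 0 q = 0.
Proof. by rewrite /left_field; exact: linear0. Qed.

Section Geodesic.
Variables (x0 P0 : pt) (r : R) (x P : R -> pt).
Hypotheses (r0 : 0 < r) (Hx : normal_geodesic G x0 P0 r x P)
  (Hu : forall t : R, 0 <= t <= r -> enorm (usubmx (P t)) = 1)
  (Hs : forall t : R, 0 <= t <= r -> ccsphere G x0 t (x t))
  (Hd : forall t : R, 0 < t <= r -> differentiable (dc G x0) (x t)).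

Lemma dc_geodesic (t : R) : 0 <= t <= r -> dc G x0 (x t) = t.
Proof. by move=> /Hs; rewrite /ccsphere /dc /= => ->. Qed.

Lemma dc_line (t : R) (v : pt) (e : R) : 0 < t <= r -> 0 < e ->
  exists2 d : R, 0 < d & forall s, - d <= s <= d ->
    `|dc G x0 (x t + s *: v) - t| < e.
Proof.
move=> t0r e0.
have tr : 0 <= t <= r by have /andP[/ltW -> ->] := t0r.
have z0 : - 1 <= (0 : R) <= 1 by rewrite lerN10 ler01.
have dl : deriv_in (- 1) 1 (fun s : R => x t + s *: v) 0 v by exact: deriv_in_line.
have df : differentiable (dc G x0) (x t + (0 : R) *: v).
  by rewrite scale0r addr0; exact: Hd.
have /nbhs_ballP[d /= d0 H] := deriv_in_cvg (deriv_in_comp z0 df dl) e0.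
exists (Num.min (d / 2) 1); first by rewrite lt_min divr_gt0/=.
move=> s; rewrite -ler_norml le_min => /andP[sd s1].
have := H s; rewrite /= scale0r addr0 dc_geodesic//; apply.
  rewrite -ball_normE /= sub0r normrN; apply: le_lt_trans sd _.
  by rewrite ltr_pdivrMr//; lra.
by rewrite -ler_norml.
Qed.

Lemma deriv_in_dc_line (t : R) v (d : R) : 0 < t <= r -> 0 < d ->
  deriv_in (- d) d (fun s => dc G x0 (x t + s *: v)) 0 ('d (dc G x0) (x t) v).
Proof.
move=> t0r d0.
have z0 : - d <= (0 : R) <= d by rewrite oppr_le0 ltW.
have df : differentiable (dc G x0) (x t + (0 : R) *: v).
  by rewrite scale0r addr0; exact: Hd.
have dl : deriv_in (- d) d (fun s : R => x t + s *: v) 0 v by exact: deriv_in_line.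
have := deriv_in_comp z0 df dl.
by rewrite scale0r addr0.
Qed.

(** Move [q] from [x t] on the chart line tangent to X_J. The momentum of the quotient is at most 0,
    with value 0 at the start, so its derivative vanishes: <P, X_J - lam P_H> = 0, where [lam] is
    the derivative of the distance along X_J. *)
Lemma grad_dc_small : exists2 t1 : R, 0 < t1 <= r & forall t, 0 < t < t1 ->
  grad G (dc G x0) (x t) = P t.
Proof.
have [t1 /andP[t10 t1r] cal] := calibration r0 Hx Hu.
exists t1; first by rewrite t10.
have calD q : 0 < dc G x0 q < t1 ->
    momentum G x0 P0 (q ** inv (x (dc G x0 q)) - e1) <= 0.
  move=> /andP[q0 qt1]; rewrite leNgt; apply/negP => m0.
  set l := dc G x0 q in q0 qt1 m0.
  have lr : 0 <= l <= r by rewrite ltW//= (le_trans (ltW qt1)).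
  have dq : deriv_in 0 r (fun=> q) l (left_field G 0 q).
    rewrite left_field0.
    exact: deriv_in_cst.
  have dz := deriv_in_quotient lr dq (normal_geodesic_deriv Hx lr).
  have L : linear (momentum G x0 P0) by move=> k a b; rewrite momentumD momentumZ.
  have dm := deriv_in_linear L lr (deriv_inD dz (deriv_in_cst 0 r (- e1) l)).
  have /nbhs_ballP[d /= d0 H] := deriv_in_cvg dm m0.
  (* The distance is approached by curves of length [L'] slightly above [l]. The bound [d] keeps the
     momentum positive at time [L'], by continuity, while [t1 - l] keeps [L'] in the range of
     [calibration]; the two conflict. *)
  have e0 : 0 < Num.min d (t1 - l) by rewrite lt_min d0 subr_gt0.
  have [a [b [y [L' [yab ya yb EL /andP[lL Ll]]]]]] := near_minimizer q0 e0.
  move: Ll; rewrite -/l -ltrBlDl lt_min => /andP[Ld Lt1].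
  have := cal a b y L' yab ya EL; rewrite yb => /(_ _) cal'.
  have bL : ball l d L' by rewrite -ball_normE /= distrC ger0_norm// subr_ge0.
  have lL' : l <= L' by [].
  have := H L' bL; have -> : 0 <= L' <= r.
    by rewrite (le_trans (ltW q0) lL') /= (le_trans _ t1r)//; lra.
  move=> /(_ isT); rewrite ltr_norml => /andP[K _].
  have : momentum G x0 P0 (q ** inv (x L') - e1) <= 0 by apply: cal'; lra.
  by move: K; rewrite /=; lra.
move=> t /andP[t0 tt1]; apply/matrixP => J k; rewrite (ord1 k) mxE => {k}.
have tr : 0 <= t <= r by rewrite ltW//= (le_trans (ltW tt1)).
have t0r : 0 < t <= r by rewrite t0; have /andP[] := tr.
pose v := X G J (x t).
have m0 : 0 < Num.min t (t1 - t) by rewrite lt_min t0 subr_gt0.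
have [d d0 Hd'] := dc_line v t0r m0.
pose y s := x t + s *: v.
pose tau s := dc G x0 (y s).
have taur s : - d <= s <= d -> 0 < tau s < t1.
  by move=> /Hd'; rewrite -/(y s) -/(tau s) lt_min !ltr_norml; lra.
have z0 : - d <= (0 : R) <= d by rewrite oppr_le0 ltW.
have dtau := deriv_in_dc_line (v := v) t0r d0.
have y0 : y 0 = x t by rewrite /y scale0r addr0.
have tau0 : tau 0 = t by rewrite /tau y0 dc_geodesic.
have taur' s : - d <= s <= d -> 0 <= tau s <= r.
  by move=> /taur/andP[/ltW -> /= /ltW]; move=> /le_trans; apply.
have dx := normal_geodesic_deriv Hx tr; rewrite -{1}tau0 in dx.
have dxt := deriv_in_time z0 taur' dtau dx.
have dy : deriv_in (- d) d y 0 (left_field G (cframe G J) (y 0)).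
  by rewrite y0; exact: deriv_in_line.
pose lam := 'd (dc G x0) (x t) v.
have dxt' : deriv_in (- d) d (x \o tau) 0
    (left_field G (lam *: hlift G (P t)) ((x \o tau) 0)).
  by move: dxt; rewrite /= tau0 /left_field diffZE.
have dz := deriv_in_quotient z0 dy dxt'.
have L : linear (momentum G x0 P0) by move=> k a b; rewrite momentumD momentumZ.
have dm := deriv_in_linear L z0 (deriv_inD dz (deriv_in_cst (- d) d (- e1) 0)).
have m00 : momentum G x0 P0 0 = 0 by rewrite -[0](scale0r 0) momentumZ mul0r.
have := deriv_in_max d0 dm.
rewrite /= tau0 y0 gmulgV left_field1 addr0 subrr m00 => E.
have {E} : momentum G x0 P0 (Ad G (x t) (cframe G J - lam *: hlift G (P t))) = 0.
  by apply: E => s sd; apply: calD; exact: taur.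
rewrite (momentum_Ad _ Hx tr).
have -> : frame_coord G (cframe G J - lam *: hlift G (P t)) =
    delta_mx J 0 - lam *: pad (usubmx (P t)).
  by rewrite addrC -scaleNr -[cframe G J](frame_vec_delta G) -frame_vecE frame_vecK
    scaleNr addrC.
(* Here <P, P_H> = |P_H|^2 = 1, so the equation reads P_J = lam. *)
rewrite dotvDr dotvNr dotvZr dotv_delta dotv_pad -enorm_sqr Hu// expr1n mulr1.
by move=> /eqP; rewrite subr_eq0 => /eqP ->.
Qed.

Lemma grad_dc_propagate (s t : R) : 0 < s -> s < t -> t <= r ->
  grad G (dc G x0) (x s) = P s -> grad G (dc G x0) (x t) = P t.
Proof.
move=> s0 st tr gs; apply/matrixP => J k; rewrite (ord1 k) => {k}.
have sr : 0 <= s <= r by rewrite ltW//= (le_trans (ltW st)).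
have tr' : 0 <= t <= r by rewrite (ltW (lt_trans s0 st)).
have s0r : 0 < s <= r by rewrite s0 (le_trans (ltW st)).
have t0r : 0 < t <= r by rewrite (lt_trans s0 st).
(* The direction is chosen so that, when [q] leaves [x s] with velocity [w], the translate [q ** g]
   leaves [x t] with velocity X_J. *)
pose g := inv (x s) ** x t; pose w := Ad G g (cframe G J).
pose v := left_field G w (x s).
have [d d0 Hd'] := dc_line v s0r s0.
pose y u := x s + u *: v.
have z0 : - d <= (0 : R) <= d by rewrite oppr_le0 ltW.
have y0 : y 0 = x s by rewrite /y scale0r addr0.
have dy : deriv_in (- d) d y 0 (left_field G w (y 0)).
  by rewrite y0; exact: deriv_in_line.
(* Right translation by [g] is treated as the quotient by the constant curve [inv g]. *)
have dc0 : deriv_in (- d) d (fun=> inv g) 0 (left_field G 0 (inv g)).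
  rewrite left_field0.
  exact: deriv_in_cst.
have dz := deriv_in_quotient z0 dy dc0.
have E0 : y 0 ** inv (inv g) = x t by rewrite y0 ginvK /g gmulVKg.
rewrite E0 subr0 /w AdKV in dz.
have df : differentiable (dc G x0) (y 0 ** inv (inv g)) by rewrite E0; exact: Hd.
have dt := deriv_in_comp z0 df dz.
have ds := deriv_in_dc_line (v := v) s0r d0.
have := deriv_inD dt (deriv_in_scale (deriv_in_cst (- d) d (-1 : R) 0) ds).
move=> /(deriv_in_max d0) E.
have {E} : 'd (dc G x0) (y 0 ** inv (inv g)) (left_field G (cframe G J) (x t)) +
    (0 *: dc G x0 (x s + 0 *: v) + -1 *: 'd (dc G x0) (x s) v) = 0.
  apply: E => u ud; rewrite /= E0 scale0r addr0 !dc_geodesic// !scaleN1r.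
  (* Equality holds at [u = 0], so the difference of the two distances has a maximum there. *)
  suff : dc G x0 (y u ** inv (inv g)) <= dc G x0 (y u) + (t - s).
    by rewrite -/(y u); lra.
  apply/ler_addgt0Pl => e e0.
  have yu0 : 0 < dc G x0 (y u).
    by have := Hd' u ud; rewrite ltr_norml -/(y u) => /andP[]; lra.
  have [a [b [c [L [cab ca cb EL /andP[_ Le]]]]]] := near_minimizer yu0 e0.
  apply: (@le_trans _ _ (L + (t - s))); last by lra.
  apply: dc_le; have := ccdist_le_tail Hx Hu (ltW s0) st tr cab EL.
  by rewrite ca cb -gmulA ginvK.
rewrite scale0r add0r E0 scaleN1r => /eqP; rewrite subr_eq0 => /eqP.
move=> E; rewrite mxE; apply: (etrans E).
apply: (etrans (diff_grad (dc G x0) (x s) w)); rewrite gs.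
(* Conservation of momentum: the pairing of [P s] with [Ad g X_J] is [xi (Ad (x t) X_J)], the
   pairing of [P t] with X_J. *)
by rewrite -(momentum_Ad _ Hx sr) /w -AdM gmulVKg (momentum_Ad _ Hx tr')
  frame_coord_frame dotv_delta.
Qed.

Lemma grad_dc (t : R) : 0 < t <= r -> grad G (dc G x0) (x t) = P t.
Proof.
have [t1 /andP[t10 t1r] H] := grad_dc_small.
move=> /andP[t0 tr]; have [tt1|t1t] := ltP t t1; first by apply: H; rewrite t0.
have t120 : 0 < t1 / 2 by rewrite divr_gt0.
have t12 : t1 / 2 < t1 by lra.
apply: (@grad_dc_propagate (t1 / 2)) => //; first exact: lt_le_trans t12 t1t.
by apply: H; rewrite t120.
Qed.

End Geodesic.
End Distance.

(** * Horizontal and vertical normals and the system of equations *)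

Section GaussLemma.
Context {R : realType} {h m : nat} (G : carnot_group R h m).
Local Notation n := (h + m)%N.
Local Notation pt := ('cV[R]_n).

Lemma enormZ k (c : R) (v : 'cV[R]_k) : 0 <= c -> enorm (c *: v) = c * enorm v.
Proof.
move=> c0; rewrite /enorm dotvZr [dotv (c *: v) v]dotvC dotvZr mulrA -expr2.
by rewrite sqrtrM ?sqr_ge0// sqrtr_sqr ger0_norm.
Qed.

(** The length of the gradient cancels in both quotients, which leaves a division by the norm of its
    horizontal part, here 1. *)
Lemma normals_of_grad x0 (z p : pt) : grad G (dc G x0) z = p ->
  enorm (usubmx p) = 1 -> nuH G x0 z = usubmx p /\ varpi G x0 z = dsubmx p.
Proof.
move=> gp p1.
have p0 : 0 < enorm p.
  rewrite sqrtr_gt0 -[p]vsubmxK /dotv big_split_ord /=.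
  apply: ltr_pwDl; last by apply: sumr_ge0 => i _; rewrite -expr2 sqr_ge0.
  have -> : \sum_(i < h) col_mx (usubmx p) (dsubmx p) (lshift m i) 0 *
      col_mx (usubmx p) (dsubmx p) (lshift m i) 0 = 1; last exact: ltr01.
    transitivity (dotv (usubmx p) (usubmx p)); last by rewrite -enorm_sqr p1 expr1n.
    by apply: eq_bigr => i _; rewrite col_mxEu.
have c0 : 0 < (enorm p)^-1 by rewrite invr_gt0.
have uE : usubmx ((enorm p)^-1 *: p) = (enorm p)^-1 *: usubmx p by exact: linearZ.
have dE : dsubmx ((enorm p)^-1 *: p) = (enorm p)^-1 *: dsubmx p by exact: linearZ.
rewrite /nuH /varpi /unit_normal gp uE dE enormZ ?(ltW c0)// p1 mulr1 invrK.
by split; rewrite scalerA mulfV ?gt_eqF// scale1r.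
Qed.

(** Two horizontal fields have their bracket in the second layer, so the block of [CV] acting
    between horizontal components retains only the indices of degree 2. *)
Lemma CV_horizontal (Z : 'cV[R]_m) (u : 'cV[R]_h) :
  usubmx (CV G Z *m pad u) = CH G Z *m u.
Proof.
apply/matrixP => i k; rewrite (ord1 k) mxE mxE [RHS]mxE big_split_ord /=.
rewrite [X in _ + X]big1 ?addr0; last by move=> a _; rewrite pad_rshift mulr0.
apply: eq_bigr => j _; rewrite /pad col_mxEu; congr (_ * _).
rewrite /CV /CH !summxE [RHS]big_mkcond /=; apply: eq_bigr => a _.
case: eqP => [_|/eqP da]; first by rewrite !mxE.
have dj : cdeg G (lshift m j) = 1%N by apply/eqP; rewrite cdeg_horizontal /=.
have C0 : Cmx G (rshift h a) (lshift m i) (lshift m j) = 0.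
  by apply: Cmx_eq0 => //=; rewrite dj.
by rewrite mxE C0 mulr0.
Qed.

(** At [t = 0] the value of [along] is a limit from the right; it is [f 0] because [f], being
    differentiable there, is continuous. *)
Lemma along_eq (V : normedModType R) (F : pt -> V) (f : R -> V) (x : R -> pt)
    (r : R) (l : V) : 0 < r -> deriv_in 0 r f 0 l ->
  (forall t, 0 < t <= r -> F (x t) = f t) ->
  forall t, 0 <= t <= r -> along F x t = f t.
Proof.
move=> r0 df Ff t /andP[t0 tr]; rewrite /along; have [->|tn0] := eqVneq t 0.
  apply/cvg_lim; first exact: norm_hausdorff.
  apply/cvgrPdist_lt => e e0.
  have H := deriv_in_cvg df e0; rewrite near_withinE.
  apply: filterS2 H (near_dist (0 : R) r0) => s K; rewrite subr0 => sr s0.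
  have s0r : 0 < s <= r by rewrite s0 ltW// (le_lt_trans (ler_norm s)).
  by rewrite Ff// distrC K// ltW//=; have /andP[] := s0r.
by rewrite Ff// lt_neqAle eq_sym tn0 t0.
Qed.

End GaussLemma.

Unset Implicit Arguments.
Set Strict Implicit.
Set Printing Implicit Defensive.

Theorem proposition2p29 (R : realType) (h m : nat) (G : carnot_group R h m)
  (hG : no_strictly_abnormal_minimizers G)
  (x0 : 'cV[R]_(h + m)) (P0 : 'cV[R]_(h + m)) (r : R)
  (x : R -> 'cV[R]_(h + m)) (P : R -> 'cV[R]_(h + m))
  (hr : 0 < r)
  (hx : normal_geodesic G x0 P0 r x P)
  (hunit : forall t : R, 0 <= t <= r -> enorm (usubmx (P t)) = 1)
  (hsphere : forall t : R, 0 <= t <= r -> ccsphere G x0 t (x t))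
  (hnormal : forall t : R, 0 < t <= r -> differentiable (dc G x0) (x t)) :
  let nu := along (nuH G x0) x in
  let w := along (varpi G x0) x in
  forall t : R, 0 <= t <= r ->
    [/\ deriv_in 0 r x t (hvec G (x t) (nu t)),
        deriv_in 0 r nu t (- (CH G (w t) *m nu t)) &
        deriv_in 0 r w t (- dsubmx (CV G (w t) *m pad (nu t)))].
Proof.
move=> nu w.
have [_ _ H] := hx.
have gradP t : 0 < t <= r ->
    nuH G x0 (x t) = usubmx (P t) /\ varpi G x0 (x t) = dsubmx (P t).
  move=> /[dup] t0r /andP[t0 tr]; apply: normals_of_grad.
    exact: (grad_dc hr hx hunit hsphere hnormal).
  by rewrite hunit// ltW.
have dU t : 0 <= t <= r -> deriv_in 0 r (fun s => usubmx (P s)) t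
    (- (CH G (dsubmx (P t)) *m usubmx (P t))).
  move=> t0r; have [_ dP] := H t t0r; rewrite -CV_horizontal.
  apply: deriv_in_col => i.
  have := deriv_in_coord (i := lshift m i) dP; rewrite [in X in X -> _]mxE [in X in _ -> X]mxE.
  rewrite [usubmx (_ *m _) i 0]mxE.
  by apply: deriv_in_ext => // s _; rewrite mxE.
have dD t : 0 <= t <= r -> deriv_in 0 r (fun s => dsubmx (P s)) t
    (- dsubmx (CV G (dsubmx (P t)) *m pad (usubmx (P t)))).
  move=> t0r; have [_ dP] := H t t0r.
  apply: deriv_in_col => i.
  have := deriv_in_coord (i := rshift h i) dP; rewrite [in X in X -> _]mxE [in X in _ -> X]mxE.
  rewrite [dsubmx (_ *m _) i 0]mxE.
  by apply: deriv_in_ext => // s _; rewrite mxE.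
have z0 : 0 <= (0 : R) <= r by rewrite lexx ltW.
(* The covector curve supplies the limit of the normals at the centre, where the sphere degenerates
   to a point. *)
have nuE t : 0 <= t <= r -> nu t = usubmx (P t).
  by apply: (along_eq hr (dU 0 z0)) => s /gradP[].
have wE t : 0 <= t <= r -> w t = dsubmx (P t).
  by apply: (along_eq hr (dD 0 z0)) => s /gradP[].
move=> t t0r; rewrite nuE// wE//; split; first by have [] := H t t0r.
  by apply: deriv_in_ext (dU t t0r) => // s /nuE.
by apply: deriv_in_ext (dD t t0r) => // s /wE.
Qed.
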